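(* Let $x$ be a nondegenerate space curve in $\mathbf{A}^3$ without affine inflection points that is general-affine extremal, with first and second general-affine curvatures $k$ and $M$ and sign $\epsilon=\pm1$. Then $x$ belongs to a linear complex if and only if $M=\epsilon k$ and $k$ satisfies \[ k'''+\tfrac32kk''+\tfrac12(k')^2+\tfrac12k^2k'+\epsilon k'=0, \] where $'$ denotes the derivative with respect to the general-affine length parameter.
   Context: All curves are smooth. A parametrized curve $x=x(t)$ in $\mathbf{A}^3$ is nondegenerate if $x',x'',x'''$ are linearly independent at every point. For a nondegenerate curve there exist a frame $e_1,e_2,e_3$ along $x$ (smooth, pointwise linearly independent vector fields along $x$, with $e_1$ a positive multiple of $dx/dt$), a $1$-form $\omega$ and functions $\ell,m$ such that $dx=\omega e_1$, $de_1=\omega e_2$, $de_2=\omega e_3$, $de_3=-m\omega e_1-\ell\omega e_2$. These are unique up to $\tilde e_i=\lambda^ie_i$ ($i=1,2,3$), $\tilde\omega=\lambda^{-1}\omega$, $\tilde\ell=\lambda^2\ell$, $\tilde m=\lambda^3m$ with a constant $\lambda>0$. A point where $\ell=0$ is an affine inflection point. Where $\ell\neq0$, the sign is $\epsilon=\mathrm{sign}(\ell)$. The general-affine length element is $\omega_s=\sqrt{\epsilon\ell}\,\omega$; a general-affine length parameter is a parameter $s$ with $ds=\omega_s$. The first general-affine curvature $k$ is defined by $d\ell/\ell=k\,\omega_s$, and the second general-affine curvature is $M=m/(\epsilon\ell)^{3/2}$. Variations: a compactly supported deformation of $x$ is a smooth family of nondegenerate curves $x_\eta$, $\eta$ near $0$,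 with $x_0=x$, with $x_\eta(t)=x(t)$ for $t$ outside a compact set $C$ of parameters, and such that no $x_\eta$ has an affine inflection point. The curve $x$ is general-affine extremal if, for every compactly supported deformation, $L(\eta)=\int_C\omega_s(\eta)$ satisfies $\frac{dL}{d\eta}\big|_{\eta=0}=0$. Linear complex: regard $x$ as the curve $t\mapsto[1:x(t)]$ in $\mathbf{P}^3$. It belongs to a linear complex if the curve of its tangent lines, viewed in the $5$-dimensional projective space containing the (Plücker) manifold of lines of $\mathbf{P}^3$, lies in a $4$-dimensional hyperplane. In terms of a homogeneous lift satisfying $y''''+6P_2y''+4P_3y'+P_4y=0$, this is the condition $\theta_3:=P_3-\tfrac32P_2'\equiv0$. *)

(* Defs.v *)
From Stdlib Require Import Reals.
From Coquelicot Require Import Coquelicot.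

Open Scope R_scope.

(* Affine 3-space, with Coquelicot's normed module structure on products. *)
Notation vec3 := (R * R * R)%type.

Definition coord (i : nat) (v : vec3) : R :=
  match i with
  | 0%nat => fst (fst v)
  | 1%nat => snd (fst v)
  | _ => snd v
  end.

Definition Rbar_interval (a b : Rbar) (t : R) : Prop :=
  Rbar_lt a t /\ Rbar_lt t b.

(* In the definitions below [I] is an open interval of parameters. *)
Definition smooth_fun (I : R -> Prop) (f : R -> R) : Prop :=
  forall n t, I t -> ex_derive_n f n t.

Definition smooth_curve (I : R -> Prop) (x : R -> vec3) : Prop :=
  forall i, smooth_fun I (fun t => coord i (x t)).

Definition curve_derive_n (x : R -> vec3) (n : nat) (t : R) : vec3 :=
  (Derive_n (fun u => coord 0 (x u)) n t,
   Derive_n (fun u => coord 1 (x u)) n t,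
   Derive_n (fun u => coord 2 (x u)) n t).

Definition lin_indep3 (u v w : vec3) : Prop :=
  forall p q r : R,
    plus (plus (scal p u) (scal q v)) (scal r w) = zero ->
    p = 0 /\ q = 0 /\ r = 0.

Definition nondegenerate (I : R -> Prop) (x : R -> vec3) : Prop :=
  forall t, I t ->
    lin_indep3 (curve_derive_n x 1 t) (curve_derive_n x 2 t)
               (curve_derive_n x 3 t).

(* The 1-form omega of the moving frame is [omega F t dt]. *)
Record frame := Frame {
  e1 : R -> vec3;
  e2 : R -> vec3;
  e3 : R -> vec3;
  omega : R -> R;
  ell : R -> R;
  mm : R -> R
}.

(* As dx = omega e1, positivity of [omega F] says that e1 is a positive
   multiple of dx/dt. *)
Definition is_frame (I : R -> Prop) (x : R -> vec3) (F : frame) : Prop :=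
  (smooth_curve I (e1 F) /\ smooth_curve I (e2 F) /\ smooth_curve I (e3 F)) /\
  (smooth_fun I (omega F) /\ smooth_fun I (ell F) /\ smooth_fun I (mm F)) /\
  forall t, I t ->
    lin_indep3 (e1 F t) (e2 F t) (e3 F t) /\
    0 < omega F t /\
    is_derive x t (scal (omega F t) (e1 F t)) /\
    is_derive (e1 F) t (scal (omega F t) (e2 F t)) /\
    is_derive (e2 F) t (scal (omega F t) (e3 F t)) /\
    is_derive (e3 F) t
      (plus (scal (- mm F t * omega F t) (e1 F t))
            (scal (- ell F t * omega F t) (e2 F t))).

Definition affine_inflection (I : R -> Prop) (x : R -> vec3) (t : R) : Prop :=
  exists F, is_frame I x F /\ ell F t = 0.

Definition no_affine_inflection (I : R -> Prop) (x : R -> vec3) : Prop :=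
  forall t, I t -> ~ affine_inflection I x t.

(* The general-affine length element is [length_density F t dt]; it does not
   depend on the choice of the frame [F] of a given curve. *)
Definition length_density (F : frame) (t : R) : R :=
  sqrt (sign (ell F t) * ell F t) * omega F t.

Definition length_parameter (I : R -> Prop) (F : frame) (s : R -> R) : Prop :=
  forall t, I t -> is_derive s t (length_density F t).

(* The curvatures [k] and [M] are functions of the general-affine length
   parameter: their values at the point of parameter t are [k (s t)] and
   [M (s t)]. *)
Definition first_curvature (I : R -> Prop) (F : frame) (s k : R -> R) : Prop :=
  forall t, I t ->
    Derive (ell F) t / ell F t = k (s t) * length_density F t.

Definition second_curvature (I : R -> Prop) (F : frame) (s M : R -> R) : Prop :=
  forall t, I t ->
    M (s t) = mm F t / Rpower (sign (ell F t) * ell F t) (3 / 2).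

(* [X eta] is the curve x_eta; the deformation is defined for |eta| < delta and
   supported in the compact interval [c, d].  Having [ex_diff_n] of every order
   at every point of an open set is being C^infinity jointly in (eta, t). *)
Definition compact_deformation (I : R -> Prop) (x : R -> vec3)
    (c d delta : R) (X : R -> R -> vec3) : Prop :=
  (0 < delta /\ c <= d /\ I c /\ I d) /\
  (forall i n eta t, Rabs eta < delta -> I t ->
     ex_diff_n (fun u v => coord i (X u v)) n eta t) /\
  (forall t, I t -> X 0 t = x t) /\
  (forall eta t, Rabs eta < delta -> I t -> ~ (c <= t <= d) ->
     X eta t = x t) /\
  (forall eta, Rabs eta < delta ->
     nondegenerate I (X eta) /\ no_affine_inflection I (X eta)).

Definition extremal (I : R -> Prop) (x : R -> vec3) : Prop :=
  forall (c d delta : R) (X : R -> R -> vec3),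
    compact_deformation I x c d delta X ->
    forall F : R -> frame,
      (forall eta, Rabs eta < delta -> is_frame I (X eta) (F eta)) ->
      is_derive (fun eta => RInt (length_density (F eta)) c d) 0 0.

Definition hom_lift (v : vec3) (i : nat) : R :=
  match i with
  | 0%nat => 1
  | S j => coord j v
  end.

(* Pluecker coordinate p_ij of the tangent line at [x t], the line of P^3
   spanned by y(t) and y'(t) with y = [1 : x]. *)
Definition tangent_plucker (x : R -> vec3) (i j : nat) (t : R) : R :=
  hom_lift (x t) i * Derive (fun u => hom_lift (x u) j) t -
  hom_lift (x t) j * Derive (fun u => hom_lift (x u) i) t.

Definition in_linear_complex (I : R -> Prop) (x : R -> vec3) : Prop :=
  exists a01 a02 a03 a12 a13 a23 : R,
    ~ (a01 = 0 /\ a02 = 0 /\ a03 = 0 /\ a12 = 0 /\ a13 = 0 /\ a23 = 0) /\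
    forall t, I t ->
      a01 * tangent_plucker x 0 1 t + a02 * tangent_plucker x 0 2 t +
      a03 * tangent_plucker x 0 3 t + a12 * tangent_plucker x 1 2 t +
      a13 * tangent_plucker x 1 3 t + a23 * tangent_plucker x 2 3 t = 0.

(* Main.v *)
Require Import Defs.
From Stdlib Require Import Reals Lra Psatz.
From Coquelicot Require Import Coquelicot.
Open Scope R_scope.

(** Write D = omega^-1 d/dt for the derivation attached to the frame, so that
    D x = e1, D e1 = e2, D e2 = e3, D e3 = - m e1 - l e2, and put
    y = [1 : x].  Everything is expressed through g = (eps l)^(-1/2), for which
    ds = omega / g, k = -2 D g and M = m g^3.

    The first condition.  A linear complex is a nonzero skew form alpha on R^4
    with alpha(y, D y) = 0.  Differentiating this repeatedly gives
    alpha(y, D^2 y) = 0, alpha(D y, D^3 y) = 0,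
    alpha(D^2 y, D^3 y) = l alpha(D y, D^2 y), and at last
    (m - D l) alpha(D y, D^2 y) = 0.  If alpha(D y, D^2 y) vanished at one point,
    alpha would vanish on the whole basis y, ..., D^3 y.  Hence m = D l.
    Conversely, if m = D l, the bivector
    y ^ D^3 y - D y ^ D^2 y + l y ^ D y is constant, and wedging with it is the
    required complex ([linear_complex_iff]).  In terms of g, the equation
    m = D l reads M = eps k.

    The second condition.  Since d/ds = g D, the left-hand side of the third
    order equation is -2 g^3 (D^4 g + eps g^-2 D^2 g) ([curvature_ode_jets]), so it
    remains to see that m = D l and extremality force
    D^4 g + eps g^-2 D^2 g = 0 ([euler_lagrange]).  The variations
    x + eta b e2 with b a bump function suffice.  To handle them one needs the
    length element of a curve that is not given with its frame: if the curve has
    the successive derivatives y1, ..., y5 for some form w dt, then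
    l omega^2 / w^2 is an explicit rational function of determinants of the y_i
    ([frame_invariant]).  This shows that small variations have no inflection
    point and gives their length as the integral of an explicit function of eta
    and t.  When m = D l, the derivative of the length at eta = 0 is a multiple
    of the integral of omega b (D^4 g + eps g^-2 D^2 g): the other terms form the
    differential of a function that vanishes together with b and its derivatives
    ([first_variation], [integration_by_parts]).  As b is arbitrary, the other
    factor is zero. *)

(** * Smooth functions of one variable *)

(** Differentiability n times, phrased by recursion on the derivative, so that
    the closure properties below are inductions on n that use only the rule for
    one derivative. *)
Fixpoint Ck (n : nat) (I : R -> Prop) (f : R -> R) : Prop :=
  match n with
  | O => True
  | S n => (forall t, I t -> ex_derive f t) /\ Ck n I (Derive f)
  end.

Lemma Ck_ext I n f g : open I -> (forall t, I t -> f t = g t) ->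
  Ck n I f -> Ck n I g.
Proof.
intros oI; revert f g; induction n as [|n IH]; intros f g E; [easy|].
assert (L : forall t, I t -> locally t (fun u => f u = g u)).
{ intros t It; apply (filter_imp I); [exact E | exact (oI t It)]. }
intros [H1 H2]; split.
- intros t It; apply (ex_derive_ext_loc f); auto.
- apply (IH (Derive f)); [|exact H2].
  intros t It; apply Derive_ext_loc; auto.
Qed.

Lemma Ck_pred I n f : Ck (S n) I f -> Ck n I f.
Proof.
revert f; induction n as [|n IH]; intros f [H1 H2]; [exact Logic.I|].
split; [exact H1 | apply IH; exact H2].
Qed.

Lemma Derive_n_Derive f n t : Derive_n (Derive f) n t = Derive_n f (S n) t.
Proof.
generalize (Derive_n_comp f n 1 t); simpl Derive_n at 2.
rewrite <- plus_n_Sm, <- plus_n_O; intros <-; apply Derive_n_ext; easy.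
Qed.

Lemma smooth_Ck I f : smooth_fun I f <-> forall n, Ck n I f.
Proof.
split.
- intros H n; revert f H; induction n as [|n IH]; intros f H; [exact Logic.I|].
  split; [intros t It; exact (H 1%nat t It)|].
  apply IH; intros [|m] t It; [exact Logic.I|].
  apply (ex_derive_ext (Derive_n f (S m))).
  + intros u; symmetry; apply Derive_n_Derive.
  + exact (H (S (S m)) t It).
- intros H n t It.
  enough (G : forall n f, Ck n I f -> ex_derive_n f n t) by apply G, H.
  clear - It; intros n; induction n as [|n IH]; intros f Hf; [exact Logic.I|].
  destruct Hf as [H1 H2].
  destruct n as [|n]; [exact (H1 t It)|].
  apply (ex_derive_ext (Derive_n (Derive f) n)); [|exact (IH _ H2)].
  intros u; apply Derive_n_Derive.
Qed.

Lemma smooth_ext I f g : open I -> (forall t, I t -> f t = g t) ->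
  smooth_fun I f -> smooth_fun I g.
Proof. rewrite !smooth_Ck; intros oI E H n; apply (Ck_ext I n f); auto. Qed.

Lemma smooth_ex_derive I f t : smooth_fun I f -> I t -> ex_derive f t.
Proof. intros H It; exact (H 1%nat t It). Qed.

Lemma smooth_is_derive I f t : smooth_fun I f -> I t -> is_derive f t (Derive f t).
Proof. intros H It; apply Derive_correct, (smooth_ex_derive I); auto. Qed.

Lemma smooth_continuous I f t : smooth_fun I f -> I t -> continuous f t.
Proof.
intros H It.
exact (ex_derive_continuous (K := R_AbsRing) (V := R_NormedModule) f t
         (smooth_ex_derive I f t H It)).
Qed.

Lemma smooth_Derive I f : smooth_fun I f -> smooth_fun I (Derive f).
Proof. rewrite !smooth_Ck; intros H n; apply (H (S n)). Qed.

Lemma smooth_step I f g : open I -> (forall t, I t -> is_derive f t (g t)) ->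
  smooth_fun I g -> smooth_fun I f.
Proof.
rewrite !smooth_Ck; intros oI H Hg [|n]; [exact Logic.I|].
split; [intros t It; exists (g t); auto|].
apply (Ck_ext I n g); auto.
intros t It; symmetry; apply is_derive_unique; auto.
Qed.

Lemma smooth_const I (c : R) : open I -> smooth_fun I (fun _ => c).
Proof.
intros oI; apply (smooth_step I _ (fun _ => 0)); auto.
- intros t _; apply @is_derive_const.
- intros n t It; revert t It.
  induction n as [|n IH]; intros t It; [exact Logic.I|].
  apply (ex_derive_ext (fun _ => 0)); [|apply ex_derive_const].
  intros u; destruct n; [reflexivity|]; rewrite Derive_n_const; reflexivity.
Qed.

Lemma smooth_id I : open I -> smooth_fun I (fun t => t).
Proof.
intros oI; apply (smooth_step I _ (fun _ => 1)); auto.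
- intros t _; apply @is_derive_id.
- apply smooth_const, oI.
Qed.

Lemma Ck_plus I n f g : open I -> Ck n I f -> Ck n I g ->
  Ck n I (fun t => f t + g t).
Proof.
intros oI; revert f g; induction n as [|n IH]; intros f g; [easy|].
intros [F1 F2] [G1 G2]; split.
- intros t It; apply @ex_derive_plus; auto.
- apply (Ck_ext I n (fun t => Derive f t + Derive g t)); auto.
  intros t It; rewrite Derive_plus; auto.
Qed.

Lemma Ck_mult I n f g : open I -> Ck n I f -> Ck n I g ->
  Ck n I (fun t => f t * g t).
Proof.
intros oI; revert f g; induction n as [|n IH]; intros f g; [easy|].
intros F G; assert (F' := Ck_pred _ _ _ F); assert (G' := Ck_pred _ _ _ G).
destruct F as [F1 F2], G as [G1 G2]; split.
- intros t It; apply @ex_derive_mult; auto.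
- apply (Ck_ext I n (fun t => Derive f t * g t + f t * Derive g t)); auto.
  + intros t It; rewrite Derive_mult; auto.
  + apply Ck_plus; auto.
Qed.

Lemma Ck_comp I J n h f : open I -> (forall t, I t -> J (f t)) ->
  smooth_fun J h -> Ck n I f -> Ck n I (fun t => h (f t)).
Proof.
intros oI HJ; revert h; induction n as [|n IH]; intros h Hh; [easy|].
intros F; assert (F' := Ck_pred _ _ _ F); destruct F as [F1 F2]; split.
- intros t It; apply ex_derive_comp; auto.
  apply (smooth_ex_derive J); auto.
- apply (Ck_ext I n (fun t => Derive f t * Derive h (f t))); auto.
  + intros t It; rewrite (Derive_comp h f); auto.
    apply (smooth_ex_derive J); auto.
  + apply Ck_mult; auto; apply IH; auto; apply smooth_Derive; auto.
Qed.

Lemma smooth_plus I f g : open I -> smooth_fun I f -> smooth_fun I g ->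
  smooth_fun I (fun t => f t + g t).
Proof. rewrite !smooth_Ck; intros; apply Ck_plus; auto. Qed.

Lemma smooth_mult I f g : open I -> smooth_fun I f -> smooth_fun I g ->
  smooth_fun I (fun t => f t * g t).
Proof. rewrite !smooth_Ck; intros; apply Ck_mult; auto. Qed.

Lemma smooth_comp I J h f : open I -> (forall t, I t -> J (f t)) ->
  smooth_fun J h -> smooth_fun I f -> smooth_fun I (fun t => h (f t)).
Proof. rewrite (smooth_Ck I f), (smooth_Ck I); intros; apply (Ck_comp I J); auto. Qed.

Lemma smooth_opp I f : open I -> smooth_fun I f -> smooth_fun I (fun t => - f t).
Proof.
intros oI H; apply (smooth_ext I (fun t => -1 * f t)); auto.
- intros; ring.
- apply smooth_mult; auto; apply smooth_const; auto.
Qed.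

Lemma smooth_minus I f g : open I -> smooth_fun I f -> smooth_fun I g ->
  smooth_fun I (fun t => f t - g t).
Proof. intros; apply smooth_plus; auto; apply smooth_opp; auto. Qed.

(** Since (1/f)' = - f' (1/f)^2, the induction hypothesis for 1/f itself closes
    the step. *)
Lemma Ck_inv I n f : open I -> (forall t, I t -> f t <> 0) -> Ck n I f ->
  Ck n I (fun t => / f t).
Proof.
intros oI nz; revert f nz; induction n as [|n IH]; intros f nz; [easy|].
intros F; assert (F' := Ck_pred _ _ _ F); destruct F as [F1 F2]; split.
- intros t It; apply ex_derive_inv; auto.
- apply (Ck_ext I n (fun t => (-1 * Derive f t) * (/ f t * / f t))); auto.
  + intros t It; rewrite Derive_inv; auto; field; auto.
  + apply Ck_mult; auto; [|apply Ck_mult; auto].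
    apply Ck_mult; auto; apply smooth_Ck, smooth_const; auto.
Qed.

Lemma smooth_inv I f : open I -> (forall t, I t -> f t <> 0) -> smooth_fun I f ->
  smooth_fun I (fun t => / f t).
Proof. rewrite !smooth_Ck; intros; apply Ck_inv; auto. Qed.

Lemma smooth_div I f g : open I -> (forall t, I t -> g t <> 0) ->
  smooth_fun I f -> smooth_fun I g -> smooth_fun I (fun t => f t / g t).
Proof. intros; apply smooth_mult; auto; apply smooth_inv; auto. Qed.

Lemma open_positive : open (fun z => 0 < z).
Proof. apply open_gt. Qed.

(** The derivative is again a multiple of a power, so the induction is over all
    exponents at once. *)
Lemma smooth_Rpower p : smooth_fun (fun z => 0 < z) (fun z => Rpower z p).
Proof.
apply smooth_Ck; intros n; revert p.
induction n as [|n IH]; intros p; [exact Logic.I|].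
assert (D : forall z, 0 < z -> is_derive (fun z => Rpower z p) z (p * Rpower z (p - 1))).
{ intros z Hz; apply is_derive_Reals, derivable_pt_lim_power; exact Hz. }
split; [intros z Hz; eexists; apply D; exact Hz|].
apply (Ck_ext _ n (fun z => p * Rpower z (p - 1))).
- apply open_positive.
- intros z Hz; symmetry; apply is_derive_unique, D, Hz.
- apply Ck_mult; [apply open_positive| |apply IH].
  apply smooth_Ck, smooth_const, open_positive.
Qed.

(** * Vectors, determinants and derivatives of curves *)

Definition det3 (u v w : vec3) : R :=
  coord 0 u * (coord 1 v * coord 2 w - coord 2 v * coord 1 w)
  - coord 1 u * (coord 0 v * coord 2 w - coord 2 v * coord 0 w)
  + coord 2 u * (coord 0 v * coord 1 w - coord 1 v * coord 0 w).

Definition comb (u v w c : vec3) : vec3 :=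
  plus (plus (scal (coord 0 c) u) (scal (coord 1 c) v)) (scal (coord 2 c) w).

(** [simpl] would also unfold the coordinates of opaque vectors; this rewrites
    only the coordinates of explicit triples. *)
Ltac coord_tac :=
  repeat match goal with
  | |- context [coord ?i (?a, ?b, ?c)] =>
      let j := eval cbv in i in
      lazymatch j with
      | 0%nat => change (coord i (a, b, c)) with a
      | 1%nat => change (coord i (a, b, c)) with b
      | S (S _) => change (coord i (a, b, c)) with c
      end
  end.

Lemma coord_plus i u v : coord i (plus u v) = coord i u + coord i v.
Proof. destruct i as [|[|i]]; reflexivity. Qed.

Lemma coord_scal i p u : coord i (scal p u) = p * coord i u.
Proof. destruct i as [|[|i]]; reflexivity. Qed.

Lemma coord_zero i : coord i zero = 0.
Proof. destruct i as [|[|i]]; reflexivity. Qed.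

Lemma coord_comb i u v w c : coord i (comb u v w c) =
  coord 0 c * coord i u + coord 1 c * coord i v + coord 2 c * coord i w.
Proof. unfold comb; rewrite !coord_plus, !coord_scal; reflexivity. Qed.

Lemma vec3_ext (u v : vec3) : (forall i, coord i u = coord i v) -> u = v.
Proof.
intros H; generalize (H 0%nat) (H 1%nat) (H 2%nat).
destruct u as [[u0 u1] u2], v as [[v0 v1] v2]; simpl; intros -> -> ->; reflexivity.
Qed.

Lemma is_derive_fst {U V : NormedModule R_AbsRing} (x : R -> prod_NormedModule R_AbsRing U V) t v :
  is_derive x t v -> is_derive (fun u => fst (x u)) t (fst v).
Proof.
intros H; apply (filterdiff_comp' x (fun z : U * V => fst z) t _ (fun z => fst z) H).
apply filterdiff_linear, is_linear_fst.
Qed.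

Lemma is_derive_snd {U V : NormedModule R_AbsRing} (x : R -> prod_NormedModule R_AbsRing U V) t v :
  is_derive x t v -> is_derive (fun u => snd (x u)) t (snd v).
Proof.
intros H; apply (filterdiff_comp' x (fun z : U * V => snd z) t _ (fun z => snd z) H).
apply filterdiff_linear, is_linear_snd.
Qed.

Lemma is_derive_coord (x : R -> vec3) t (v : vec3) i : is_derive x t v ->
  is_derive (fun u => coord i (x u)) t (coord i v).
Proof.
intros H; destruct i as [|[|i]]; simpl.
- apply (is_derive_fst (fun u => fst (x u))), is_derive_fst, H.
- apply (is_derive_snd (fun u => fst (x u))), is_derive_fst, H.
- apply is_derive_snd, H.
Qed.

Lemma is_derive_pair {U V : NormedModule R_AbsRing} (f : R -> U) (g : R -> V) t lf lg :
  is_derive f t lf -> is_derive g t lg ->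
  is_derive (fun u => (f u, g u)) t ((lf, lg) : prod_NormedModule R_AbsRing U V).
Proof.
intros Hf Hg.
apply (filterdiff_comp'_2 f g (fun (a : U) (b : V) => (a, b)) t _ _ (fun a b => (a, b)) Hf Hg).
apply (filterdiff_ext_lin _ (fun z => z)).
- apply (filterdiff_ext (fun z => z)); [intros [? ?]; reflexivity | apply filterdiff_id].
- intros [? ?]; reflexivity.
Qed.

Lemma is_derive_vec3 (x : R -> vec3) t v :
  (forall i, is_derive (fun u => coord i (x u)) t (coord i v)) -> is_derive x t v.
Proof.
intros H; destruct v as [[v0 v1] v2].
apply (is_derive_ext (fun u => (coord 0 (x u), coord 1 (x u), coord 2 (x u)))).
{ intros u; destruct (x u) as [[? ?] ?]; reflexivity. }
apply (is_derive_pair (fun u => (coord 0 (x u), coord 1 (x u))) (fun u => coord 2 (x u)));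
  [apply is_derive_pair|]; [exact (H 0%nat) | exact (H 1%nat) | exact (H 2%nat)].
Qed.

(** The cofactors of any row of the matrix with columns u, v, w are the
    coefficients of a relation between u, v and w when the determinant is zero.
    They would have to vanish, which makes u and v proportional. *)
Lemma lin_indep3_det3 u v w : lin_indep3 u v w -> det3 u v w <> 0.
Proof.
intros H D.
assert (K : forall p q r, (forall i, p * coord i u + q * coord i v + r * coord i w = 0) ->
              p = 0 /\ q = 0 /\ r = 0).
{ intros p q r E; apply H, vec3_ext; intros i.
  rewrite !coord_plus, !coord_scal, coord_zero; apply E. }
unfold det3 in D.
assert (minors : coord 0 u * coord 1 v - coord 1 u * coord 0 v = 0 /\
            coord 0 u * coord 2 v - coord 2 u * coord 0 v = 0 /\
            coord 1 u * coord 2 v - coord 2 u * coord 1 v = 0).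
{ repeat split.
  - apply (K (coord 0 v * coord 1 w - coord 1 v * coord 0 w)
             (coord 0 w * coord 1 u - coord 1 w * coord 0 u)).
    intros [|[|i]]; [ring | ring | change (coord (S (S i))) with (coord 2); lra].
  - apply (K (coord 0 v * coord 2 w - coord 2 v * coord 0 w)
             (coord 0 w * coord 2 u - coord 2 w * coord 0 u)).
    intros [|[|i]]; [ring | | change (coord (S (S i))) with (coord 2); ring]; lra.
  - apply (K (coord 1 v * coord 2 w - coord 2 v * coord 1 w)
             (coord 1 w * coord 2 u - coord 2 w * coord 1 u)).
    intros [|[|i]]; [ | ring | change (coord (S (S i))) with (coord 2); ring]; lra. }
destruct minors as (X01 & X02 & X12).
assert (U : forall i, coord i u = 0).
{ intros [|[|i]]; [| | change (coord (S (S i))) with (coord 2)].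
  - destruct (K (coord 0 v) (- coord 0 u) 0) as (_ & E & _); [|lra].
    intros [|[|j]]; [| | change (coord (S (S j))) with (coord 2)]; lra.
  - destruct (K (coord 1 v) (- coord 1 u) 0) as (_ & E & _); [|lra].
    intros [|[|j]]; [| | change (coord (S (S j))) with (coord 2)]; lra.
  - destruct (K (coord 2 v) (- coord 2 u) 0) as (_ & E & _); [|lra].
    intros [|[|j]]; [| | change (coord (S (S j))) with (coord 2)]; lra. }
destruct (K 1 0 0) as (E & _); [|lra].
intros i; rewrite U; ring.
Qed.

Lemma det3_lin_indep3 u v w : det3 u v w <> 0 -> lin_indep3 u v w.
Proof.
intros D p q r E.
assert (C : forall i, p * coord i u + q * coord i v + r * coord i w = 0).
{ intros i; generalize (f_equal (coord i) E).
  rewrite !coord_plus, !coord_scal, coord_zero; trivial. }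
repeat split; apply (Rmult_eq_reg_r (det3 u v w)); try exact D; rewrite Rmult_0_l.
- transitivity (
    (p * coord 0 u + q * coord 0 v + r * coord 0 w) * (coord 1 v * coord 2 w - coord 2 v * coord 1 w)
    - (p * coord 1 u + q * coord 1 v + r * coord 1 w) * (coord 0 v * coord 2 w - coord 2 v * coord 0 w)
    + (p * coord 2 u + q * coord 2 v + r * coord 2 w) * (coord 0 v * coord 1 w - coord 1 v * coord 0 w));
    [unfold det3; ring | rewrite !C; ring].
- transitivity (
    - (p * coord 0 u + q * coord 0 v + r * coord 0 w) * (coord 1 u * coord 2 w - coord 2 u * coord 1 w)
    + (p * coord 1 u + q * coord 1 v + r * coord 1 w) * (coord 0 u * coord 2 w - coord 2 u * coord 0 w)
    - (p * coord 2 u + q * coord 2 v + r * coord 2 w) * (coord 0 u * coord 1 w - coord 1 u * coord 0 w));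
    [unfold det3; ring | rewrite !C; ring].
- transitivity (
    (p * coord 0 u + q * coord 0 v + r * coord 0 w) * (coord 1 u * coord 2 v - coord 2 u * coord 1 v)
    - (p * coord 1 u + q * coord 1 v + r * coord 1 w) * (coord 0 u * coord 2 v - coord 2 u * coord 0 v)
    + (p * coord 2 u + q * coord 2 v + r * coord 2 w) * (coord 0 u * coord 1 v - coord 1 u * coord 0 v));
    [unfold det3; ring | rewrite !C; ring].
Qed.

Lemma det3_comb u v w a b c :
  det3 (comb u v w a) (comb u v w b) (comb u v w c) = det3 u v w * det3 a b c.
Proof. unfold det3; rewrite !coord_comb; ring. Qed.

(** * Differentiation relative to a form w dt *)

(** For w = omega this is the equiaffine derivative.  Differentiating relative
    to a form avoids changing the parameter of the curve. *)
Definition is_rel_derive (I : R -> Prop) (w f f' : R -> R) : Prop :=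
  forall t, I t -> is_derive f t (w t * f' t).

Lemma rel_derive_eq I w f g g' :
  (forall t, I t -> g t = g' t) -> is_rel_derive I w f g -> is_rel_derive I w f g'.
Proof. intros E H t It; rewrite <- E; auto. Qed.

Lemma rel_derive_ext I w f f1 g : open I -> (forall t, I t -> f t = f1 t) ->
  is_rel_derive I w f g -> is_rel_derive I w f1 g.
Proof.
intros oI E H t It; apply (is_derive_ext_loc f); auto.
apply (filter_imp I); [exact E | exact (oI t It)].
Qed.

Lemma rel_derive_unique I w f f1 g g1 : open I -> (forall t, I t -> w t <> 0) ->
  is_rel_derive I w f g -> is_rel_derive I w f1 g1 -> (forall t, I t -> f t = f1 t) ->
  forall t, I t -> g t = g1 t.
Proof.
intros oI nz H H1 E t It.
apply (rel_derive_ext I w f f1 g oI E) in H.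
apply (Rmult_eq_reg_l (w t)); auto.
rewrite <- (is_derive_unique _ _ _ (H t It)); apply is_derive_unique; auto.
Qed.

Lemma rel_derive_const I w c : is_rel_derive I w (fun _ => c) (fun _ => 0).
Proof. intros t _; rewrite Rmult_0_r; apply @is_derive_const. Qed.

Lemma rel_derive_plus I w f g f' g' : is_rel_derive I w f f' -> is_rel_derive I w g g' ->
  is_rel_derive I w (fun t => f t + g t) (fun t => f' t + g' t).
Proof. intros F G t It; rewrite Rmult_plus_distr_l; apply @is_derive_plus; auto. Qed.

Lemma rel_derive_opp I w f f' :
  is_rel_derive I w f f' -> is_rel_derive I w (fun t => - f t) (fun t => - f' t).
Proof.
intros F t It; rewrite Ropp_mult_distr_r_reverse.
apply (is_derive_opp f); auto.
Qed.

Lemma rel_derive_minus I w f g f' g' : is_rel_derive I w f f' -> is_rel_derive I w g g' ->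
  is_rel_derive I w (fun t => f t - g t) (fun t => f' t - g' t).
Proof. intros; apply rel_derive_plus; auto; apply rel_derive_opp; auto. Qed.

Lemma rel_derive_mult I w f g f' g' : is_rel_derive I w f f' -> is_rel_derive I w g g' ->
  is_rel_derive I w (fun t => f t * g t) (fun t => f' t * g t + f t * g' t).
Proof.
intros F G t It.
replace (w t * (f' t * g t + f t * g' t)) with
  (plus (mult (w t * f' t) (g t)) (mult (f t) (w t * g' t))).
- apply @is_derive_mult; auto; intros; apply Rmult_comm.
- unfold plus, mult; simpl; ring.
Qed.

Definition rel_Derive (w f : R -> R) (t : R) : R := Derive f t / w t.

Lemma rel_Derive_correct I w f :
  (forall t, I t -> w t <> 0) -> smooth_fun I f -> is_rel_derive I w f (rel_Derive w f).
Proof.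
intros nz Hf t It; unfold rel_Derive.
replace (w t * (Derive f t / w t)) with (Derive f t) by (field; auto).
apply (smooth_is_derive I); auto.
Qed.

Lemma smooth_rel_Derive I w f : open I -> (forall t, I t -> w t <> 0) ->
  smooth_fun I w -> smooth_fun I f -> smooth_fun I (rel_Derive w f).
Proof. intros; apply smooth_div; auto; apply smooth_Derive; auto. Qed.

(** The function is compared syntactically with those of the hypotheses:
    unification would unfold coordinates and derivatives. *)
Ltac rel_derive_hyp :=
  match goal with
  | H : is_rel_derive _ _ ?h _ |- is_rel_derive _ _ ?f _ =>
      let a := eval cbv beta in (fun t : R => h t) in
      let b := eval cbv beta in (fun t : R => f t) in
      constr_eq a b; exact H
  end.

Ltac rel_derive_tac :=
  lazymatch goal with
  | |- is_rel_derive _ _ (fun t => _ + _) _ => apply rel_derive_plus; rel_derive_tac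
  | |- is_rel_derive _ _ (fun t => _ - _) _ => apply rel_derive_minus; rel_derive_tac
  | |- is_rel_derive _ _ (fun t => - _) _ => apply rel_derive_opp; rel_derive_tac
  | |- is_rel_derive _ _ (fun t => _ * _) _ => apply rel_derive_mult; rel_derive_tac
  | |- is_rel_derive _ _ (fun _ => ?c) _ => apply rel_derive_const
  | |- _ => try rel_derive_hyp
  end.

Ltac smooth_hyp :=
  match goal with
  | H : smooth_fun _ ?h |- smooth_fun _ ?f =>
      let a := eval cbv beta in (fun t : R => h t) in
      let b := eval cbv beta in (fun t : R => f t) in
      constr_eq a b; exact H
  | H : smooth_curve _ ?h |- smooth_fun _ (fun t => coord ?i (?u t)) =>
      constr_eq h u; exact (H i)
  end.

Ltac smooth_tac :=
  lazymatch goal with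
  | |- smooth_fun _ (fun t => _ + _) => apply smooth_plus; [assumption| |]; smooth_tac
  | |- smooth_fun _ (fun t => _ - _) => apply smooth_minus; [assumption| |]; smooth_tac
  | |- smooth_fun _ (fun t => - _) => apply smooth_opp; [assumption|]; smooth_tac
  | |- smooth_fun _ (fun t => _ * _) => apply smooth_mult; [assumption| |]; smooth_tac
  | |- smooth_fun _ (fun _ => ?c) => apply smooth_const; assumption
  | |- _ => try smooth_hyp
  end.

(** * The length element of a curve in an arbitrary parameter *)

Lemma frame_rel_derive I x F : is_frame I x F -> forall i,
  is_rel_derive I (omega F) (fun t => coord i (x t)) (fun t => coord i (e1 F t)) /\
  is_rel_derive I (omega F) (fun t => coord i (e1 F t)) (fun t => coord i (e2 F t)) /\
  is_rel_derive I (omega F) (fun t => coord i (e2 F t)) (fun t => coord i (e3 F t)) /\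
  is_rel_derive I (omega F) (fun t => coord i (e3 F t))
    (fun t => - mm F t * coord i (e1 F t) - ell F t * coord i (e2 F t)).
Proof.
intros (_ & _ & H) i; refine (conj _ (conj _ (conj _ _))); intros t It;
  destruct (H t It) as (_ & _ & H0 & H1 & H2 & H3).
- rewrite <- coord_scal; apply is_derive_coord, H0.
- rewrite <- coord_scal; apply is_derive_coord, H1.
- rewrite <- coord_scal; apply is_derive_coord, H2.
- replace (omega F t * _) with (coord i (plus (scal (- mm F t * omega F t) (e1 F t))
            (scal (- ell F t * omega F t) (e2 F t)))).
  + apply is_derive_coord, H3.
  + rewrite coord_plus, !coord_scal; ring.
Qed.

Definition det3_second (y1 y2 y3 y4 y5 : vec3) := det3 y1 y3 y4 + det3 y1 y2 y5.
(** If a curve has the derivatives y1, ..., y5 with respect to w dt and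
    Delta = det(y1, y2, y3), then Delta' = det(y1, y2, y4),
    Delta'' = det(y1, y3, y4) + det(y1, y2, y5), and this is
    (2/3) Delta'' Delta - (35/36) Delta'^2 - det(y1, y4, y3) Delta. *)
Definition length_numerator (y1 y2 y3 y4 y5 : vec3) :=
  2 / 3 * det3_second y1 y2 y3 y4 y5 * det3 y1 y2 y3 - 35 / 36 * (det3 y1 y2 y4 * det3 y1 y2 y4)
  - det3 y1 y4 y3 * det3 y1 y2 y3.

Lemma rel_derive_unique_value I w x f f' : open I -> (forall t, I t -> w t <> 0) ->
  is_rel_derive I w x f -> is_rel_derive I w x f' -> forall t, I t -> f t = f' t.
Proof. intros oI nz H H'; apply (rel_derive_unique I w x x); auto. Qed.

(** Let r = omega / w.  In the frame e1, e2, e3 the derivatives y1, ..., y5 have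
    coordinates that are polynomials in r, l, m and their derivatives, because
    y1 = r e1 and differentiation multiplies the frame equations by r.  So
    Delta = r^6 det(e1, e2, e3), and in the numerator all derivatives of
    r cancel, which leaves l r^14 det(e1, e2, e3)^2.  In particular
    l omega^2 depends on the curve alone. *)
Lemma frame_invariant I x G w y1 y2 y3 y4 y5 :
  open I -> is_frame I x G -> smooth_fun I w -> (forall t, I t -> w t <> 0) ->
  (forall i, is_rel_derive I w (fun t => coord i (x t)) (fun t => coord i (y1 t))) ->
  (forall i, is_rel_derive I w (fun t => coord i (y1 t)) (fun t => coord i (y2 t))) ->
  (forall i, is_rel_derive I w (fun t => coord i (y2 t)) (fun t => coord i (y3 t))) ->
  (forall i, is_rel_derive I w (fun t => coord i (y3 t)) (fun t => coord i (y4 t))) ->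
  (forall i, is_rel_derive I w (fun t => coord i (y4 t)) (fun t => coord i (y5 t))) ->
  forall t, I t ->
  det3 (y1 t) (y2 t) (y3 t) <> 0 /\
  length_numerator (y1 t) (y2 t) (y3 t) (y4 t) (y5 t) * w t ^ 2 =
  det3 (y1 t) (y2 t) (y3 t) ^ 2 * (ell G t * omega G t ^ 2).
Proof.
intros oI HG Sw nz Y1 Y2 Y3 Y4 Y5.
assert (HF := frame_rel_derive I x G HG).
destruct HG as (_ & (So & Sl & Sm) & HG).
set (r := fun t => omega G t / w t).
assert (Er : forall t, I t -> omega G t = w t * r t)
  by (intros t It; unfold r; field; auto).
assert (conv : forall f f', is_rel_derive I (omega G) f f' -> is_rel_derive I w f (fun t => r t * f' t)).
{ intros f f' H t It; rewrite <- Rmult_assoc, <- Er; auto. }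
assert (Sr : smooth_fun I r) by (apply smooth_div; auto).
assert (R1 := rel_Derive_correct I w r nz Sr); set (r1 := rel_Derive w r) in R1.
assert (Sr1 : smooth_fun I r1) by (apply smooth_rel_Derive; auto).
assert (R2 := rel_Derive_correct I w r1 nz Sr1); set (r2 := rel_Derive w r1) in R2.
assert (Sr2 : smooth_fun I r2) by (apply smooth_rel_Derive; auto).
assert (R3 := rel_Derive_correct I w r2 nz Sr2); set (r3 := rel_Derive w r2) in R3.
assert (Sr3 : smooth_fun I r3) by (apply smooth_rel_Derive; auto).
assert (R4 := rel_Derive_correct I w r3 nz Sr3); set (r4 := rel_Derive w r3) in R4.
assert (L1 := rel_Derive_correct I w _ nz Sl); set (l1 := rel_Derive w (ell G)) in L1.
assert (M1 := rel_Derive_correct I w _ nz Sm); set (m1 := rel_Derive w (mm G)) in M1.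
clearbody r1 r2 r3 r4 l1 m1.
assert (E1 : forall i t, I t -> coord i (y1 t) = r t * coord i (e1 G t)).
{ intros i; apply (rel_derive_unique_value I w (fun t => coord i (x t))); auto; apply conv, HF. }
assert (E2 : forall i t, I t -> coord i (y2 t) =
          r1 t * coord i (e1 G t) + r t * r t * coord i (e2 G t)).
{ intros i; destruct (HF i) as (_ & A1 & A2 & A3).
  apply conv in A1, A2, A3.
  refine (rel_derive_unique I w _ _ _ _ oI nz (Y2 i) _ (E1 i)).
  eapply rel_derive_eq; [|rel_derive_tac]; intros t It; cbv beta; ring. }
assert (E3 : forall i t, I t -> coord i (y3 t) =
          r2 t * coord i (e1 G t) + 3 * r t * r1 t * coord i (e2 G t)
          + r t * r t * r t * coord i (e3 G t)).
{ intros i; destruct (HF i) as (_ & A1 & A2 & A3).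
  apply conv in A1, A2, A3.
  refine (rel_derive_unique I w _ _ _ _ oI nz (Y3 i) _ (E2 i)).
  eapply rel_derive_eq; [|rel_derive_tac]; intros t It; cbv beta; ring. }
assert (E4 : forall i t, I t -> coord i (y4 t) =
          (r3 t - mm G t * (r t * r t * r t * r t)) * coord i (e1 G t)
          + (4 * r t * r2 t + 3 * r1 t * r1 t - ell G t * (r t * r t * r t * r t))
             * coord i (e2 G t)
          + 6 * r t * r t * r1 t * coord i (e3 G t)).
{ intros i; destruct (HF i) as (_ & A1 & A2 & A3).
  apply conv in A1, A2, A3.
  refine (rel_derive_unique I w _ _ _ _ oI nz (Y4 i) _ (E3 i)).
  eapply rel_derive_eq; [|rel_derive_tac]; intros t It; cbv beta; ring. }
assert (E5 : forall t, I t -> exists p q, forall i, coord i (y5 t) =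
          p * coord i (e1 G t) + q * coord i (e2 G t)
          + (15 * r t * r1 t * r1 t + 10 * r t * r t * r2 t
             - ell G t * (r t * r t * r t * r t * r t)) * coord i (e3 G t)).
{ intros t It.
  exists (r4 t - m1 t * (r t * r t * r t * r t) - mm G t * 4 * (r t * r t * r t * r1 t)
          - 6 * r t * r t * r1 t * r t * mm G t).
  exists ((r3 t - mm G t * (r t * r t * r t * r t)) * r t +
     4 * (r1 t * r2 t + r t * r3 t) + 6 * r1 t * r2 t
     - l1 t * (r t * r t * r t * r t) - ell G t * 4 * (r t * r t * r t * r1 t)
          - 6 * r t * r t * r1 t * r t * ell G t).
  revert t It; intros t It i.
  destruct (HF i) as (_ & A1 & A2 & A3).
  apply conv in A1, A2, A3.
  revert t It.
  refine (rel_derive_unique I w _ _ _ _ oI nz (Y5 i) _ (E4 i)).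
  eapply rel_derive_eq; [|rel_derive_tac]; intros t It; cbv beta; ring. }
intros t It.
destruct (HG t It) as (LI & po & _); apply lin_indep3_det3 in LI.
destruct (E5 t It) as (p & q & E5').
assert (rpos : r t <> 0).
{ intros Z; rewrite (Er t It), Z in po; lra. }
set (d := det3 (e1 G t) (e2 G t) (e3 G t)) in LI.
assert (C : forall y c, (forall i, coord i y = coord i (comb (e1 G t) (e2 G t) (e3 G t) c)) ->
                   y = comb (e1 G t) (e2 G t) (e3 G t) c)
  by (intros y c; apply vec3_ext).
(* The coordinates of y1, ..., y5 in the frame; the values p and q of the
   first two coordinates of y5 do not enter the determinants. *)
assert (C1 : y1 t = comb (e1 G t) (e2 G t) (e3 G t) (r t, 0, 0)).
{ apply C; intros i; rewrite E1, coord_comb by exact It; coord_tac; ring. }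
assert (C2 : y2 t = comb (e1 G t) (e2 G t) (e3 G t) (r1 t, r t ^ 2, 0)).
{ apply C; intros i; rewrite E2, coord_comb by exact It; coord_tac; ring. }
assert (C3 : y3 t = comb (e1 G t) (e2 G t) (e3 G t) (r2 t, 3 * r t * r1 t, r t ^ 3)).
{ apply C; intros i; rewrite E3, coord_comb by exact It; coord_tac; ring. }
assert (C4 : y4 t = comb (e1 G t) (e2 G t) (e3 G t) (r3 t - mm G t * r t ^ 4,
   4 * r t * r2 t + 3 * r1 t ^ 2 - ell G t * r t ^ 4, 6 * r t ^ 2 * r1 t)).
{ apply C; intros i; rewrite E4, coord_comb by exact It; coord_tac; ring. }
assert (C5 : y5 t = comb (e1 G t) (e2 G t) (e3 G t)
   (p, q, 15 * r t * r1 t ^ 2 + 10 * r t ^ 2 * r2 t - ell G t * r t ^ 5)).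
{ apply C; intros i; rewrite E5', coord_comb; coord_tac; ring. }
unfold length_numerator, det3_second; rewrite C1, C2, C3, C4, C5, !det3_comb; fold d.
replace (omega G t) with (w t * r t) by (rewrite <- Er; auto).
unfold det3; coord_tac; split; [|field].
match goal with |- ?a <> 0 => replace a with (d * r t ^ 6) by ring end.
apply Rmult_integral_contrapositive; split; [exact LI | apply pow_nonzero; exact rpos].
Qed.

(** * Existence of the frame of a nondegenerate curve *)

Lemma rel_derive_det3 I w (u v z u' v' z' : R -> vec3) :
  (forall i, is_rel_derive I w (fun t => coord i (u t)) (fun t => coord i (u' t))) ->
  (forall i, is_rel_derive I w (fun t => coord i (v t)) (fun t => coord i (v' t))) ->
  (forall i, is_rel_derive I w (fun t => coord i (z t)) (fun t => coord i (z' t))) ->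
  is_rel_derive I w (fun t => det3 (u t) (v t) (z t))
    (fun t => det3 (u' t) (v t) (z t) + det3 (u t) (v' t) (z t) + det3 (u t) (v t) (z' t)).
Proof.
intros U V Z; unfold det3.
assert (U0 := U 0%nat); assert (U1 := U 1%nat); assert (U2 := U 2%nat).
assert (V0 := V 0%nat); assert (V1 := V 1%nat); assert (V2 := V 2%nat).
assert (Z0 := Z 0%nat); assert (Z1 := Z 1%nat); assert (Z2 := Z 2%nat).
eapply rel_derive_eq; [|rel_derive_tac]; intros t It; cbv beta; ring.
Qed.

Lemma smooth_det3 I (u v z : R -> vec3) : open I ->
  smooth_curve I u -> smooth_curve I v -> smooth_curve I z ->
  smooth_fun I (fun t => det3 (u t) (v t) (z t)).
Proof. intros oI U V Z; unfold det3; smooth_tac; auto. Qed.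

Lemma cramer (u v z f : vec3) i : det3 u v z * coord i f =
  det3 f v z * coord i u + det3 u f z * coord i v + det3 u v f * coord i z.
Proof.
destruct i as [|[|i]]; [| |change (coord (S (S i))) with (coord 2)]; unfold det3; ring.
Qed.

(** The change of derivation from w dt to dt is triangular with diagonal
    w, w^2, w^3. *)
Lemma det3_curve_derive_n I w x (y1 y2 y3 : R -> vec3) :
  open I -> smooth_fun I w ->
  (forall i, is_rel_derive I w (fun t => coord i (x t)) (fun t => coord i (y1 t))) ->
  (forall i, is_rel_derive I w (fun t => coord i (y1 t)) (fun t => coord i (y2 t))) ->
  (forall i, is_rel_derive I w (fun t => coord i (y2 t)) (fun t => coord i (y3 t))) ->
  forall t, I t ->
  det3 (curve_derive_n x 1 t) (curve_derive_n x 2 t) (curve_derive_n x 3 t) =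
  w t ^ 6 * det3 (y1 t) (y2 t) (y3 t).
Proof.
intros oI Sw Y1 Y2 Y3.
assert (W1 := fun t It => smooth_is_derive I w t Sw It).
assert (W2 := fun t It => smooth_is_derive I _ t (smooth_Derive _ _ Sw) It).
set (w1 := Derive w) in *; set (w2 := Derive w1) in *.
assert (one : forall f f', (forall t, I t -> is_derive f t (f' t)) ->
   is_rel_derive I (fun _ => 1) f f').
{ intros f f' H t It; rewrite Rmult_1_l; auto. }
assert (conv : forall f f', is_rel_derive I w f f' -> is_rel_derive I (fun _ => 1) f (fun t => w t * f' t)).
{ intros f f' H; apply one, H. }
assert (dn : forall f g g', (forall t, I t -> f t = g t) ->
   is_rel_derive I (fun _ => 1) g g' -> forall t, I t -> Derive f t = g' t).
{ intros f g g' E H t It; apply is_derive_unique; rewrite <- (Rmult_1_l (g' t)).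
  revert t It; apply (rel_derive_ext I (fun _ => 1) g); auto.
  intros; symmetry; auto. }
apply one in W1, W2; clearbody w1 w2.
assert (E1 : forall i t, I t ->
   Derive_n (fun u => coord i (x u)) 1 t = w t * coord i (y1 t)).
{ intros i; assert (A1 := conv _ _ (Y1 i)).
  exact (dn _ _ _ (fun t _ => eq_refl) A1). }
assert (E2 : forall i t, I t ->
   Derive_n (fun u => coord i (x u)) 2 t = w1 t * coord i (y1 t) + w t ^ 2 * coord i (y2 t)).
{ intros i; assert (A2 := conv _ _ (Y2 i)).
  apply (dn _ _ _ (E1 i)).
  eapply rel_derive_eq; [|rel_derive_tac]; intros t It; cbv beta; ring. }
assert (E3 : forall i t, I t ->
   Derive_n (fun u => coord i (x u)) 3 t = w2 t * coord i (y1 t) +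
     3 * w t * w1 t * coord i (y2 t) + w t ^ 3 * coord i (y3 t)).
{ intros i; assert (A2 := conv _ _ (Y2 i)); assert (A3 := conv _ _ (Y3 i)).
  apply (dn _ (fun t => w1 t * coord i (y1 t) + w t * w t * coord i (y2 t))).
  - intros t It; rewrite <- (Rmult_1_r (w t)) at 2; exact (E2 i t It).
  - eapply rel_derive_eq; [|rel_derive_tac]; intros t It; cbv beta; ring. }
intros t It.
assert (C : forall c n, (forall i, Derive_n (fun u => coord i (x u)) n t =
          coord i (comb (y1 t) (y2 t) (y3 t) c)) ->
       curve_derive_n x n t = comb (y1 t) (y2 t) (y3 t) c).
{ intros c n H; apply vec3_ext; intros i; rewrite <- H.
  destruct i as [|[|i]]; reflexivity. }
rewrite (C (w t, 0, 0) 1%nat), (C (w1 t, w t ^ 2, 0) 2%nat),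
  (C (w2 t, 3 * w t * w1 t, w t ^ 3) 3%nat).
- rewrite det3_comb; unfold det3; coord_tac; ring.
- intros i; rewrite E3, coord_comb by exact It; coord_tac; ring.
- intros i; rewrite E2, coord_comb by exact It; coord_tac; ring.
- intros i; rewrite E1, coord_comb by exact It; coord_tac; ring.
Qed.

Definition rel_Derive_curve (w : R -> R) (x : R -> vec3) (t : R) : vec3 :=
  (rel_Derive w (fun u => coord 0 (x u)) t,
   rel_Derive w (fun u => coord 1 (x u)) t,
   rel_Derive w (fun u => coord 2 (x u)) t).

Lemma coord_rel_Derive_curve w x t i :
  coord i (rel_Derive_curve w x t) = rel_Derive w (fun u => coord i (x u)) t.
Proof. destruct i as [|[|i]]; reflexivity. Qed.

Lemma smooth_rel_Derive_curve I w x :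
  open I -> (forall t, I t -> w t <> 0) -> smooth_fun I w ->
  smooth_curve I x -> smooth_curve I (rel_Derive_curve w x).
Proof.
intros oI nz Sw Sx i.
apply (smooth_ext I (rel_Derive w (fun u => coord i (x u)))); auto.
- intros t _; symmetry; apply coord_rel_Derive_curve.
- apply smooth_rel_Derive; auto.
Qed.

Lemma rel_derive_curve I w x :
  (forall t, I t -> w t <> 0) -> smooth_curve I x -> forall i,
  is_rel_derive I w (fun t => coord i (x t)) (fun t => coord i (rel_Derive_curve w x t)).
Proof.
intros nz Sx i; eapply rel_derive_eq; [|apply rel_Derive_correct; auto].
intros t _; symmetry; apply coord_rel_Derive_curve.
Qed.

(** The sixth root of |det(x', x'', x''')|; the square makes it smooth whatever
    the sign of the determinant. *)
Definition equiaffine_density (x : R -> vec3) (t : R) : R :=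
  Rpower (det3 (curve_derive_n x 1 t) (curve_derive_n x 2 t) (curve_derive_n x 3 t) ^ 2)
    (/ 12).

(** The coefficients [ell] and [mm] are read off by Cramer's rule. *)
Definition equiaffine_frame (x : R -> vec3) : frame :=
  let w := equiaffine_density x in
  let e1 := rel_Derive_curve w x in
  let e2 := rel_Derive_curve w e1 in
  let e3 := rel_Derive_curve w e2 in
  let f := rel_Derive_curve w e3 in
  {| e1 := e1; e2 := e2; e3 := e3; omega := w;
     ell := fun t => - (det3 (e1 t) (f t) (e3 t) / det3 (e1 t) (e2 t) (e3 t));
     mm := fun t => - (det3 (f t) (e2 t) (e3 t) / det3 (e1 t) (e2 t) (e3 t)) |}.

(** The density is chosen so that det(e1, e2, e3)^2 = 1.  Differentiating, the
    derivative of e3 has no component along e3, and Cramer's rule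
    expresses it in terms of e1 and e2. *)
Lemma equiaffine_frame_is_frame I x : open I -> smooth_curve I x -> nondegenerate I x ->
  is_frame I x (equiaffine_frame x).
Proof.
intros oI Sx Nx.
set (w := equiaffine_density x).
assert (pos : forall t, 0 < w t) by (intros t; apply exp_pos).
assert (nz : forall t, I t -> w t <> 0) by (intros t _; generalize (pos t); lra).
assert (D0 : forall t, I t -> det3 (curve_derive_n x 1 t) (curve_derive_n x 2 t)
              (curve_derive_n x 3 t) <> 0)
  by (intros t It; apply lin_indep3_det3, Nx, It).
assert (Sd : forall n, smooth_curve I (curve_derive_n x n)).
{ intros n i; apply (smooth_ext I (Derive_n (fun u => coord i (x u)) n)); auto.
  - intros t _; destruct i as [|[|i]]; reflexivity.
  - clear -Sx; induction n as [|n IH]; [apply Sx | apply smooth_Derive, IH]. }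
assert (Sw : smooth_fun I w).
{ apply (smooth_comp I (fun z => 0 < z) (fun z => Rpower z (/ 12))
     (fun t => det3 (curve_derive_n x 1 t) (curve_derive_n x 2 t) (curve_derive_n x 3 t) ^ 2)).
  - exact oI.
  - intros t It; assert (H := D0 t It); nra.
  - apply smooth_Rpower.
  - apply (smooth_ext I (fun t =>
      det3 (curve_derive_n x 1 t) (curve_derive_n x 2 t) (curve_derive_n x 3 t) *
      det3 (curve_derive_n x 1 t) (curve_derive_n x 2 t) (curve_derive_n x 3 t))); auto.
    + intros t _; ring.
    + smooth_tac; apply smooth_det3; auto. }
set (f1 := rel_Derive_curve w x); set (f2 := rel_Derive_curve w f1); set (f3 := rel_Derive_curve w f2); set (f4 := rel_Derive_curve w f3).
assert (S1 : smooth_curve I f1) by (apply smooth_rel_Derive_curve; auto).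
assert (S2 : smooth_curve I f2) by (apply smooth_rel_Derive_curve; auto).
assert (S3 : smooth_curve I f3) by (apply smooth_rel_Derive_curve; auto).
assert (S4 : smooth_curve I f4) by (apply smooth_rel_Derive_curve; auto).
assert (M1 := rel_derive_curve I w x nz Sx); fold f1 in M1.
assert (M2 := rel_derive_curve I w f1 nz S1); fold f2 in M2.
assert (M3 := rel_derive_curve I w f2 nz S2); fold f3 in M3.
assert (M4 := rel_derive_curve I w f3 nz S3); fold f4 in M4.
set (d := fun t => det3 (f1 t) (f2 t) (f3 t)).
assert (w12 : forall t, I t -> w t ^ 12 = det3 (curve_derive_n x 1 t)
    (curve_derive_n x 2 t) (curve_derive_n x 3 t) ^ 2).
{ intros t It; unfold w, equiaffine_density; rewrite <- Rpower_pow by apply exp_pos.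
  rewrite Rpower_mult; replace (/ 12 * INR 12) with 1 by (simpl; field).
  apply Rpower_1; assert (H := D0 t It); nra. }
assert (d2 : forall t, I t -> d t * d t = 1).
{ intros t It; apply (Rmult_eq_reg_l (w t ^ 12)).
  - transitivity ((w t ^ 6 * d t) ^ 2); [ring|].
    unfold d; rewrite <- (det3_curve_derive_n I w x f1 f2 f3) by auto.
    rewrite Rmult_1_r; symmetry; auto.
  - apply pow_nonzero; auto. }
assert (dnz : forall t, I t -> d t <> 0).
{ intros t It H; assert (K := d2 t It); rewrite H in K; lra. }
assert (d' : forall t, I t -> det3 (f1 t) (f2 t) (f4 t) = 0).
{ assert (Md := rel_derive_det3 I w f1 f2 f3 f2 f3 f4 M2 M3 M4); fold d in Md.
  intros t It.
  assert (K := rel_derive_unique I w _ _ _ _ oI nz (rel_derive_mult I w _ _ _ _ Md Md)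
      (rel_derive_const I w 1) d2 t It); cbv beta in K.
  assert (Z : 2 * d t * det3 (f1 t) (f2 t) (f4 t) = 0).
  { rewrite <- K; unfold d, det3; ring. }
  apply Rmult_integral in Z; destruct Z as [Z|Z]; [|exact Z].
  exfalso; apply (dnz t It); lra. }
split; [|split].
- auto.
- split; [exact Sw|]; split; simpl; (apply smooth_opp; [exact oI|]; apply smooth_div; auto;
    apply smooth_det3; auto).
- intros t It.
  assert (V : forall x y i, (forall i, is_rel_derive I w (fun t => coord i (x t)) (fun t => coord i (y t))) ->
     is_derive (fun t => coord i (x t)) t (coord i (scal (w t) (y t)))).
  { intros y y' i H; rewrite coord_scal; apply H, It. }
  split; [apply det3_lin_indep3; exact (dnz t It)|].
  split; [exact (pos t)|].
  split; [|split; [|split]]; apply is_derive_vec3; intros i;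
   [apply V, M1 | apply V, M2 | apply V, M3 |].
  simpl; fold w; fold f1; fold f2; fold f3; fold f4.
  match goal with |- is_derive _ _ ?l =>
    replace l with (w t * coord i (f4 t)); [apply M4, It|] end.
  rewrite coord_plus, !coord_scal.
  assert (K := cramer (f1 t) (f2 t) (f3 t) (f4 t) i).
  rewrite (d' t It) in K; fold (d t) in K |- *.
  replace (coord i (f4 t)) with ((det3 (f4 t) (f2 t) (f3 t) * coord i (f1 t) +
     det3 (f1 t) (f4 t) (f3 t) * coord i (f2 t)) / d t).
  + field; auto.
  + apply (Rmult_eq_reg_l (d t)); auto; rewrite K; field; auto.
Qed.

(** * Linear complexes *)

Lemma Rbar_interval_open a b : open (Rbar_interval a b).
Proof. apply open_and; [apply open_Rbar_gt | apply open_Rbar_lt]. Qed.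

Lemma Rbar_interval_convex a b t u z : Rbar_interval a b t -> Rbar_interval a b u ->
  t <= z <= u -> Rbar_interval a b z.
Proof.
intros [H1 H2] [K1 K2] [Z1 Z2]; split.
- apply (Rbar_lt_le_trans _ t); auto.
- apply (Rbar_le_lt_trans _ u); auto.
Qed.

Lemma Rbar_interval_inhabited a b : Rbar_lt a b -> exists t, Rbar_interval a b t.
Proof.
destruct a as [a| |], b as [b| |]; simpl; intros H; try easy.
- exists ((a + b) / 2); split; simpl; lra.
- exists (a + 1); split; simpl; [lra | exact Logic.I].
- exists (b - 1); split; simpl; [exact Logic.I | lra].
- exists 0; split; simpl; exact Logic.I.
Qed.

Lemma rel_derive_zero_constant a b w f :
  is_rel_derive (Rbar_interval a b) w f (fun _ => 0) ->
  forall t u, Rbar_interval a b t -> Rbar_interval a b u -> f t = f u.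
Proof.
intros H.
assert (K : forall t u, Rbar_interval a b t -> Rbar_interval a b u -> t < u -> f t = f u).
{ intros t u It Iu tu; apply (eq_is_derive f); auto.
  intros z Hz; assert (K := H z (Rbar_interval_convex a b t u z It Iu Hz)).
  rewrite Rmult_0_r in K; exact K. }
intros t u It Iu; destruct (Rtotal_order t u) as [L|[L|L]].
- apply K; auto.
- rewrite L; reflexivity.
- symmetry; apply K; auto.
Qed.

Lemma tangent_plucker_0 I x F j t : is_frame I x F -> I t ->
  tangent_plucker x 0 (S j) t = omega F t * coord j (e1 F t).
Proof.
intros HF It; unfold tangent_plucker; simpl hom_lift.
destruct (frame_rel_derive I x F HF j) as (H & _).
rewrite (is_derive_unique _ _ _ (H t It)), Derive_const; ring.
Qed.

Lemma tangent_plucker_S I x F i j t : is_frame I x F -> I t ->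
  tangent_plucker x (S i) (S j) t =
  omega F t * (coord i (x t) * coord j (e1 F t) - coord j (x t) * coord i (e1 F t)).
Proof.
intros HF It; unfold tangent_plucker; simpl hom_lift.
destruct (frame_rel_derive I x F HF j) as (H & _).
destruct (frame_rel_derive I x F HF i) as (K & _).
rewrite (is_derive_unique _ _ _ (H t It)), (is_derive_unique _ _ _ (K t It)); ring.
Qed.

Definition dot (u v : vec3) : R :=
  coord 0 u * coord 0 v + coord 1 u * coord 1 v + coord 2 u * coord 2 v.

Lemma dot_zero u v z al : det3 u v z <> 0 ->
  dot al u = 0 -> dot al v = 0 -> dot al z = 0 -> forall i, coord i al = 0.
Proof.
intros D U V Z.
destruct (det3_lin_indep3 (coord 0 u, coord 0 v, coord 0 z) (coord 1 u, coord 1 v, coord 1 z)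
  (coord 2 u, coord 2 v, coord 2 z)) with (p := coord 0 al) (q := coord 1 al) (r := coord 2 al)
  as (E0 & E1 & E2).
- replace (det3 _ _ _) with (det3 u v z) by (unfold det3; coord_tac; ring); exact D.
- apply vec3_ext; intros i; rewrite !coord_plus, !coord_scal, coord_zero.
  unfold dot in U, V, Z; destruct i as [|[|i]]; coord_tac; assumption.
- intros [|[|i]]; assumption.
Qed.

Lemma rel_derive_dot I w u (v v' : R -> vec3) :
  (forall i, is_rel_derive I w (fun t => coord i (v t)) (fun t => coord i (v' t))) ->
  is_rel_derive I w (fun t => dot u (v t)) (fun t => dot u (v' t)).
Proof.
intros H; unfold dot; assert (H0 := H 0%nat); assert (H1 := H 1%nat); assert (H2 := H 2%nat).
eapply rel_derive_eq; [|rel_derive_tac]; intros t It; cbv beta; ring.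
Qed.

Lemma rel_derive_det3_const I w b (u v u' v' : R -> vec3) :
  (forall i, is_rel_derive I w (fun t => coord i (u t)) (fun t => coord i (u' t))) ->
  (forall i, is_rel_derive I w (fun t => coord i (v t)) (fun t => coord i (v' t))) ->
  is_rel_derive I w (fun t => det3 b (u t) (v t))
    (fun t => det3 b (u' t) (v t) + det3 b (u t) (v' t)).
Proof.
intros U V; eapply rel_derive_eq; [|apply (rel_derive_det3 I w (fun _ => b) u v (fun _ => zero)); auto].
- intros t _; unfold det3; rewrite !coord_zero; ring.
- intros i; rewrite coord_zero; apply rel_derive_const.
Qed.

(** A skew form on R^4 is a pair: a linear form al on R^3, for the
    pairs (1, 0), (0, v), and the form u, v |-> det(be, u, v).  The hypothesis on
    al and be is alpha(y, D y) = 0; it is differentiated five times. *)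
Lemma tangents_in_linear_complex I w (x f1 f2 f3 : R -> vec3) l l1 m (al be : vec3) :
  open I -> (forall t, I t -> w t <> 0) ->
  (forall t, I t -> det3 (f1 t) (f2 t) (f3 t) <> 0) ->
  is_rel_derive I w l l1 ->
  (forall i, is_rel_derive I w (fun t => coord i (x t)) (fun t => coord i (f1 t))) ->
  (forall i, is_rel_derive I w (fun t => coord i (f1 t)) (fun t => coord i (f2 t))) ->
  (forall i, is_rel_derive I w (fun t => coord i (f2 t)) (fun t => coord i (f3 t))) ->
  (forall i, is_rel_derive I w (fun t => coord i (f3 t))
     (fun t => - m t * coord i (f1 t) - l t * coord i (f2 t))) ->
  (forall t, I t -> dot al (f1 t) + det3 be (x t) (f1 t) = 0) ->
  (forall t, I t -> m t = l1 t) \/ (forall i, coord i al = 0 /\ coord i be = 0).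
Proof.
intros oI nz D L X0 X1 X2 X3' C1.
set (f4 := fun t => comb (f1 t) (f2 t) (f3 t) (- m t, - l t, 0)).
assert (X3 : forall i, is_rel_derive I w (fun t => coord i (f3 t)) (fun t => coord i (f4 t))).
{ intros i; eapply rel_derive_eq; [|apply X3']; intros t _; unfold f4; rewrite coord_comb.
  coord_tac; ring. }
clear X3'.
assert (Z : forall f f', is_rel_derive I w f f' -> (forall t, I t -> f t = 0) -> forall t, I t -> f' t = 0).
{ intros f f' H; exact (rel_derive_unique I w f _ f' _ oI nz H (rel_derive_const I w 0)). }
assert (C2 : forall t, I t -> dot al (f2 t) + det3 be (x t) (f2 t) = 0).
{ intros t It; transitivity (dot al (f2 t) +
     (det3 be (f1 t) (f1 t) + det3 be (x t) (f2 t))); [unfold det3; ring|].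
  revert t It; refine (Z _ _ _ C1).
  apply rel_derive_plus; [apply rel_derive_dot | apply rel_derive_det3_const]; auto. }
assert (C3 : forall t, I t -> dot al (f3 t) + (det3 be (f1 t) (f2 t) + det3 be (x t) (f3 t)) = 0).
{ refine (Z _ _ _ C2).
  apply rel_derive_plus; [apply rel_derive_dot | apply rel_derive_det3_const]; auto. }
assert (C4 : forall t, I t -> det3 be (f1 t) (f3 t) = 0).
{ assert (K : forall t, I t -> dot al (f4 t) + ((det3 be (f2 t) (f2 t) + det3 be (f1 t) (f3 t))
      + (det3 be (f1 t) (f3 t) + det3 be (x t) (f4 t))) = 0).
  { refine (Z _ _ _ C3).
    apply rel_derive_plus; [apply rel_derive_dot | apply rel_derive_plus; apply rel_derive_det3_const]; auto. }
  intros t It.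
  transitivity ((dot al (f4 t) + ((det3 be (f2 t) (f2 t) + det3 be (f1 t) (f3 t))
      + (det3 be (f1 t) (f3 t) + det3 be (x t) (f4 t)))
      + m t * (dot al (f1 t) + det3 be (x t) (f1 t))
      + l t * (dot al (f2 t) + det3 be (x t) (f2 t))) / 2).
  - unfold f4, dot, det3; rewrite !coord_comb; coord_tac; field.
  - rewrite (K t It), (C1 t It), (C2 t It); field. }
assert (C5 : forall t, I t -> det3 be (f2 t) (f3 t) - l t * det3 be (f1 t) (f2 t) = 0).
{ assert (K : forall t, I t -> det3 be (f2 t) (f3 t) + det3 be (f1 t) (f4 t) = 0).
  { refine (Z _ _ _ C4); apply rel_derive_det3_const; auto. }
  intros t It; rewrite <- (K t It); unfold f4, det3.
  rewrite !coord_comb; coord_tac; ring. }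
assert (C6 : forall t, I t -> (m t - l1 t) * det3 be (f1 t) (f2 t) = 0).
{ assert (K : forall t, I t -> (det3 be (f3 t) (f3 t) + det3 be (f2 t) (f4 t))
     - (l1 t * det3 be (f1 t) (f2 t)
        + l t * (det3 be (f2 t) (f2 t) + det3 be (f1 t) (f3 t))) = 0).
  { refine (Z _ _ _ C5).
    apply rel_derive_minus; [|apply rel_derive_mult; [exact L|]]; apply rel_derive_det3_const; auto. }
  intros t It; rewrite <- (K t It), (C4 t It); unfold f4, det3.
  rewrite !coord_comb; coord_tac; ring. }
destruct (Classical_Prop.classic (exists t, I t /\ det3 be (f1 t) (f2 t) = 0)) as [(t & It & B12)|N].
- right.
  assert (B13 := C4 t It); assert (B23 := C5 t It); rewrite B12 in B23.
  assert (B : forall i, coord i be = 0).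
  { intros i; apply (Rmult_eq_reg_l (det3 (f1 t) (f2 t) (f3 t))); auto.
    rewrite cramer.
    replace (det3 (f1 t) (f2 t) be) with (det3 be (f1 t) (f2 t)) by (unfold det3; ring).
    replace (det3 (f1 t) be (f3 t)) with (- det3 be (f1 t) (f3 t)) by (unfold det3; ring).
    rewrite B12, B13; replace (det3 be (f2 t) (f3 t)) with 0 by lra; ring. }
  assert (B0 : forall u v, det3 be u v = 0) by (intros; unfold det3; rewrite !B; ring).
  assert (A1 := C1 t It); assert (A2 := C2 t It); assert (A3 := C3 t It).
  rewrite B0 in A1, A2; rewrite 2!B0 in A3.
  intros i; split; [|apply B].
  apply (dot_zero (f1 t) (f2 t) (f3 t)); auto; lra.
- left; intros t It.
  destruct (Rmult_integral _ _ (C6 t It)) as [K|K]; [lra|].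
  exfalso; apply N; exists t; auto.
Qed.

(** For the converse, p and q below are the Pluecker coordinates of the
    constant bivector y ^ D^3 y - D y ^ D^2 y + l y ^ D y, and the coefficients
    of the complex are their Hodge dual. *)
Lemma linear_complex_iff a b x F : Rbar_lt a b -> is_frame (Rbar_interval a b) x F ->
  in_linear_complex (Rbar_interval a b) x <->
  forall t, Rbar_interval a b t -> Derive (ell F) t = mm F t * omega F t.
Proof.
intros hab HF.
assert (oI := Rbar_interval_open a b).
destruct (Rbar_interval_inhabited a b hab) as (t0 & It0).
set (I := Rbar_interval a b) in *.
assert (HD := frame_rel_derive I x F HF); assert (HF' := HF).
destruct HF as (_ & (So & Sl & Sm) & HF).
assert (wnz : forall t, I t -> omega F t <> 0).
{ intros t It; destruct (HF t It) as (_ & p & _); lra. }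
assert (D : forall t, I t -> det3 (e1 F t) (e2 F t) (e3 F t) <> 0).
{ intros t It; apply lin_indep3_det3, HF, It. }
assert (L := rel_Derive_correct I (omega F) _ wnz Sl).
split.
- intros (a01 & a02 & a03 & a12 & a13 & a23 & nz & H).
  destruct (tangents_in_linear_complex I (omega F) x (e1 F) (e2 F) (e3 F) (ell F)
     (rel_Derive (omega F) (ell F)) (mm F) (a01, a02, a03) (a23, - a13, a12))
    as [K|K]; auto; try (intros i; apply HD).
  + intros t It; apply (Rmult_eq_reg_l (omega F t)); auto; rewrite Rmult_0_r, <- (H t It).
    rewrite !(tangent_plucker_0 I x F), !(tangent_plucker_S I x F) by auto.
    unfold dot, det3; coord_tac; ring.
  + intros t It; rewrite (K t It); unfold rel_Derive; field; auto.
  + exfalso; apply nz.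
    generalize (K 0%nat) (K 1%nat) (K 2%nat); coord_tac.
    intros (? & ?) (? & ?) (? & ?); repeat split; lra.
- intros E.
  assert (L' : is_rel_derive I (omega F) (ell F) (mm F)).
  { eapply rel_derive_eq; [|exact L]; intros t It; unfold rel_Derive; rewrite (E t It); field; auto. }
  set (q := fun i j t => coord i (x t) * coord j (e3 F t) - coord j (x t) * coord i (e3 F t)
     - (coord i (e1 F t) * coord j (e2 F t) - coord j (e1 F t) * coord i (e2 F t))
     + ell F t * (coord i (x t) * coord j (e1 F t) - coord j (x t) * coord i (e1 F t))).
  set (p := fun j t => coord j (e3 F t) + ell F t * coord j (e1 F t)).
  assert (Q : forall i j t, I t -> q i j t = q i j t0).
  { intros i j t It; apply (rel_derive_zero_constant a b (omega F)); auto; fold I.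
    destruct (HD i) as (I0 & I1 & I2 & I3); destruct (HD j) as (J0 & J1 & J2 & J3).
    unfold q; eapply rel_derive_eq; [|rel_derive_tac]; intros u Iu; cbv beta; ring. }
  assert (P : forall j t, I t -> p j t = p j t0).
  { intros j t It; apply (rel_derive_zero_constant a b (omega F)); auto; fold I.
    destruct (HD j) as (J0 & J1 & J2 & J3).
    unfold p; eapply rel_derive_eq; [|rel_derive_tac]; intros u Iu; cbv beta; ring. }
  exists (q 1%nat 2%nat t0), (- q 0%nat 2%nat t0), (q 0%nat 1%nat t0),
    (p 2%nat t0), (- p 1%nat t0), (p 0%nat t0); split.
  + intros (_ & _ & _ & P2 & P1 & P0).
    destruct (HF t0 It0) as (LI & _).
    destruct (LI (ell F t0) 0 1) as (_ & _ & K); [|lra].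
    apply vec3_ext; intros i; rewrite !coord_plus, !coord_scal, coord_zero.
    unfold p in P0, P1, P2.
    destruct i as [|[|i]]; [| |change (coord (S (S i))) with (coord 2)]; lra.
  + intros t It.
    rewrite !(tangent_plucker_0 I x F), !(tangent_plucker_S I x F) by auto.
    rewrite <- !(Q _ _ t), <- !(P _ t) by exact It; unfold q, p; ring.
Qed.

(** * Curvatures as functions of the length parameter *)

Lemma is_derive_linear_bound f x l (e : posreal) : is_derive f x l ->
  exists d : posreal, forall h, Rabs h < d -> Rabs (f (x + h) - f x - l * h) <= e * Rabs h.
Proof.
intros H; apply is_derive_Reals in H.
destruct (H e (cond_pos e)) as (d & Hd); exists d; intros h hd.
destruct (Req_dec h 0) as [->|hn].
- rewrite Rplus_0_r.
  replace (f x - f x - l * 0) with 0 by ring; rewrite Rabs_R0; lra.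
- replace (f (x + h) - f x - l * h) with (((f (x + h) - f x) / h - l) * h) by (field; exact hn).
  rewrite Rabs_mult; apply Rmult_le_compat_r; [apply Rabs_pos|].
  left; apply Hd; auto.
Qed.

(** Chain rule for a function known only along a parametrization s: no inverse
    of s is constructed.  A value near s(t) is attained at a nearby u by the
    intermediate value theorem, |s(u) - s(t)| is bounded below by
    (s'/2) |u - t|, and h - (h'/s') s has zero derivative at t. *)
Lemma is_derive_reparam (I : R -> Prop) s s' f h h' t : open I -> I t ->
  (forall u, I u -> ex_derive s u) -> is_derive s t s' -> 0 < s' ->
  (forall u, I u -> f (s u) = h u) -> is_derive h t h' ->
  is_derive f (s t) (h' / s').
Proof.
intros oI It Cs Ds ps E Dh.
assert (Dp : is_derive (fun u => h u - h' / s' * s u) t 0).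
{ replace 0 with (h' - h' / s' * s') by (field; lra).
  apply @is_derive_minus; [exact Dh | apply is_derive_scal, Ds]. }
apply is_derive_Reals; intros e pe.
assert (pe1 : 0 < e * s' / 4) by (apply Rdiv_lt_0_compat; [apply Rmult_lt_0_compat|]; lra).
assert (pe2 : 0 < s' / 2) by lra.
destruct (is_derive_linear_bound _ _ _ (mkposreal _ pe1) Dp) as (d1 & B1).
destruct (is_derive_linear_bound _ _ _ (mkposreal _ pe2) Ds) as (d2 & B2).
destruct (oI t It) as (d3 & B3).
simpl in B1, B2.
set (r := Rmin d1 (Rmin d2 d3) / 2).
assert (pr : 0 < r /\ r < d1 /\ r < d2 /\ r < d3).
{ unfold r; generalize (cond_pos d1) (cond_pos d2) (cond_pos d3).
  unfold Rmin; repeat destruct Rle_dec; intros; repeat split; lra. }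
destruct pr as (pr & r1 & r2 & r3).
assert (pd : 0 < s' / 2 * r) by (apply Rmult_lt_0_compat; lra).
exists (mkposreal _ pd); simpl; intros k kn kd.
assert (In : forall u, t - r <= u <= t + r -> I u).
{ intros u Hu; apply B3; unfold ball; simpl; unfold AbsRing_ball, abs, minus, plus, opp; simpl.
  apply Rabs_def1; lra. }
assert (Sr : s t + s' / 2 * r <= s (t + r)).
{ assert (K := B2 r ltac:(rewrite Rabs_pos_eq; lra)).
  rewrite (Rabs_pos_eq r) in K by lra; apply Rabs_le_between in K; nra. }
assert (Sl : s (t - r) <= s t - s' / 2 * r).
{ assert (K := B2 (- r) ltac:(rewrite Rabs_Ropp, Rabs_pos_eq; lra)).
  rewrite Rabs_Ropp, (Rabs_pos_eq r) in K by lra; apply Rabs_le_between in K.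
  unfold Rminus at 1; nra. }
apply Rabs_def2 in kd.
destruct (Ranalysis5.IVT_interv (fun u => s u - (s t + k)) (t - r) (t + r)) as (u & Hu & Eu).
- intros u Hu; apply continuity_pt_minus; [|apply continuity_pt_const; intros ? ?; reflexivity].
  apply continuity_pt_filterlim.
  exact (ex_derive_continuous (K := R_AbsRing) (V := R_NormedModule) s u (Cs u (In u Hu))).
- lra.
- lra.
- lra.
- assert (Es : s t + k = s u) by lra.
  rewrite Es, !E by auto.
  assert (ud : Rabs (u - t) <= r) by (apply Rabs_le_between; lra).
  assert (K1 := B1 (u - t) ltac:(lra)).
  assert (K2 := B2 (u - t) ltac:(lra)).
  replace (t + (u - t)) with u in K1, K2 by ring.
  assert (K3 : s' / 2 * Rabs (u - t) <= Rabs k).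
  { replace (s u - s t - s' * (u - t)) with (k - s' * (u - t)) in K2 by lra.
    assert (T := Rabs_triang k (s' * (u - t) - k)).
    replace (k + (s' * (u - t) - k)) with (s' * (u - t)) in T by ring.
    rewrite Rabs_mult, (Rabs_pos_eq s') in T by lra.
    rewrite Rabs_minus_sym in K2; lra. }
  apply (Rmult_lt_reg_r (Rabs k)); [apply Rabs_pos_lt, kn|].
  rewrite <- Rabs_mult.
  replace (((h u - h t) / k - h' / s') * k) with (h u - h' / s' * s u - (h t - h' / s' * s t) - 0 * (u - t)).
  + apply (Rle_lt_trans _ _ _ K1).
    assert (Rabs k > 0) by (apply Rabs_pos_lt, kn).
    apply (Rle_lt_trans _ (e / 2 * (s' / 2 * Rabs (u - t)))); [right; field|].
    apply (Rle_lt_trans _ (e / 2 * Rabs k)); [apply Rmult_le_compat_l; lra | nra].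
  + rewrite <- Es; field; split; lra.
Qed.

Lemma Derive_length_parameter I w g s f h h' : open I ->
  (forall t, I t -> 0 < w t) -> (forall t, I t -> 0 < g t) ->
  (forall t, I t -> is_derive s t (w t / g t)) ->
  is_rel_derive I w h h' -> (forall t, I t -> f (s t) = h t) ->
  forall t, I t -> Derive f (s t) = g t * h' t.
Proof.
intros oI pw pg Ds H E t It.
assert (Pw := pw t It); assert (Pg := pg t It).
transitivity (w t * h' t / (w t / g t)); [|field; lra].
apply is_derive_unique, (is_derive_reparam I s (w t / g t) f h); auto.
- intros u Iu; exists (w u / g u); auto.
- apply Rdiv_lt_0_compat; auto.
Qed.

Definition curvature_ode (eps : R) (k : R -> R) (z : R) : R :=
  Derive_n k 3 z + 3 / 2 * k z * Derive_n k 2 z + 1 / 2 * (Derive_n k 1 z) ^ 2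
  + 1 / 2 * (k z) ^ 2 * Derive_n k 1 z + eps * Derive_n k 1 z.

(** By induction on the order, each derivative of k along s is g times the
    D-derivative of the preceding one; the resulting polynomial in
    g, ..., g4 collapses. *)
Lemma curvature_ode_jets I w g g1 g2 g3 g4 s k eps : open I ->
  (forall t, I t -> 0 < w t) -> (forall t, I t -> 0 < g t) ->
  (forall t, I t -> is_derive s t (w t / g t)) ->
  is_rel_derive I w g g1 -> is_rel_derive I w g1 g2 -> is_rel_derive I w g2 g3 -> is_rel_derive I w g3 g4 ->
  (forall t, I t -> k (s t) = -2 * g1 t) ->
  forall t, I t ->
  curvature_ode eps k (s t) = -2 * g t ^ 3 * (g4 t + eps * g2 t / g t ^ 2).
Proof.
intros oI pw pg Ds G0 G1 G2 G3 K0.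
assert (DL := fun f h h' => Derive_length_parameter I w g s f h h' oI pw pg Ds).
assert (K1 : forall t, I t -> Derive_n k 1 (s t) = -2 * g t * g2 t).
{ intros t It; simpl; erewrite (DL _ (fun t => -2 * g1 t)); [| |exact K0|exact It].
  2: rel_derive_tac.
  cbv beta; ring. }
assert (K2 : forall t, I t -> Derive_n k 2 (s t) = -2 * g t * (g1 t * g2 t + g t * g3 t)).
{ intros t It; change (Derive_n k 2 (s t)) with (Derive (Derive_n k 1) (s t)).
  erewrite (DL _ (fun t => -2 * g t * g2 t)); [| |exact K1|exact It].
  2: rel_derive_tac.
  cbv beta; ring. }
assert (K3 : forall t, I t -> Derive_n k 3 (s t) =
    -2 * g t * (g1 t * (g1 t * g2 t + g t * g3 t)
      + g t * (g2 t * g2 t + 2 * g1 t * g3 t + g t * g4 t))).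
{ intros t It; change (Derive_n k 3 (s t)) with (Derive (Derive_n k 2) (s t)).
  erewrite (DL _ (fun t => -2 * g t * (g1 t * g2 t + g t * g3 t))); [| |exact K2|exact It].
  2: rel_derive_tac.
  cbv beta; ring. }
intros t It; unfold curvature_ode; rewrite K0, K1, K2, K3 by exact It.
field; assert (P := pg t It); lra.
Qed.

(** * Bump functions *)

Lemma pow_le_exp n s : 0 < s -> s ^ S n <= INR (S n) ^ S n * exp s.
Proof.
intros ps; assert (pn : 0 < INR (S n)) by apply lt_0_INR, Nat.lt_0_succ.
replace s with (INR (S n) * (s / INR (S n))) at 1 by (field; lra).
rewrite Rpow_mult_distr; apply Rmult_le_compat_l; [apply pow_le; lra|].
replace (exp s) with (exp (s / INR (S n)) ^ S n).
- apply pow_incr; split; [left; apply Rdiv_lt_0_compat; lra|].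
  generalize (exp_ineq1_le (s / INR (S n))); lra.
- rewrite <- Rpower_pow by apply exp_pos; unfold Rpower; rewrite ln_exp.
  f_equal; field; lra.
Qed.

(** The family (1/t)^k exp(-1/t), extended by 0, is stable under
    differentiation up to linear combinations. *)
Definition flat (k : nat) (t : R) : R :=
  if Rle_dec t 0 then 0 else (/ t) ^ k * exp (- / t).

(** A quadratic bound makes the derivative at 0 vanish. *)
Lemma flat_bound k t : 0 < t -> flat k t <= INR (S (S k)) ^ S (S k) * t ^ 2.
Proof.
intros pt; unfold flat; destruct (Rle_dec t 0) as [H|_]; [lra|].
assert (H := pow_le_exp (S k) (/ t) (Rinv_0_lt_compat _ pt)).
assert (P : 0 < exp (/ t)) by apply exp_pos.
rewrite exp_Ropp; apply (Rmult_le_reg_r (exp (/ t))); [exact P|].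
replace ((/ t) ^ k * / exp (/ t) * exp (/ t)) with (t ^ 2 * (/ t) ^ S (S k))
  by (simpl; field; split; lra).
assert (0 < t ^ 2) by (apply pow_lt; exact pt).
nra.
Qed.

Lemma flat_pos k t : 0 < t -> 0 < flat k t.
Proof.
intros pt; unfold flat; destruct (Rle_dec t 0) as [H|_]; [lra|].
apply Rmult_lt_0_compat; [apply pow_lt, Rinv_0_lt_compat, pt | apply exp_pos].
Qed.

Lemma flat_zero k t : t <= 0 -> flat k t = 0.
Proof. intros H; unfold flat; destruct (Rle_dec t 0); [reflexivity | lra]. Qed.

Lemma is_derive_flat k t :
  is_derive (flat k) t (flat (S (S k)) t - INR k * flat (S k) t).
Proof.
destruct (Rtotal_order t 0) as [H|[->|H]].
- rewrite !flat_zero by lra; replace (0 - INR k * 0) with 0 by ring.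
  apply (is_derive_ext_loc (fun _ => 0)); [|apply @is_derive_const].
  apply (filter_imp (fun u => u < 0)); [|apply (open_lt 0), H].
  intros u Hu; rewrite flat_zero; lra.
- rewrite !flat_zero by lra; replace (0 - INR k * 0) with 0 by ring.
  set (C := INR (S (S k)) ^ S (S k)).
  assert (pC : 0 < C) by apply pow_lt, lt_0_INR, Nat.lt_0_succ.
  apply is_derive_Reals; intros e pe.
  exists (mkposreal (e / C) (Rdiv_lt_0_compat _ _ pe pC)); simpl; intros h hn hd.
  rewrite Rplus_0_l, (flat_zero k 0), !Rminus_0_r by lra.
  destruct (Rle_dec h 0) as [hh|hh].
  + rewrite flat_zero by exact hh; unfold Rdiv; rewrite Rmult_0_l, Rabs_R0; exact pe.
  + assert (ph : 0 < h) by lra.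
    rewrite Rabs_pos_eq in hd by lra.
    rewrite Rabs_pos_eq by (left; apply Rdiv_lt_0_compat; [apply flat_pos|]; lra).
    apply (Rmult_lt_reg_r h); [exact ph|].
    replace (flat k h / h * h) with (flat k h) by (field; lra).
    apply (Rle_lt_trans _ _ _ (flat_bound k h ph)); fold C.
    replace (C * h ^ 2) with (C * h * h) by ring; apply Rmult_lt_compat_r; [exact ph|].
    apply (Rmult_lt_compat_l C) in hd; [|exact pC].
    replace (C * (e / C)) with e in hd by (field; lra); exact hd.
- apply (is_derive_ext_loc (fun u => (/ u) ^ k * exp (- / u))).
  + apply (filter_imp (fun u => 0 < u)); [|apply (open_gt 0), H].
    intros u Hu; unfold flat; destruct (Rle_dec u 0); [lra | reflexivity].
  + replace (flat (S (S k)) t - INR k * flat (S k) t) with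
      (- (INR k * / t ^ 2 * (/ t) ^ pred k) * exp (- / t)
        + (/ t) ^ k * (/ t ^ 2 * exp (- / t))).
    * auto_derive; [lra|]; field; lra.
    * unfold flat; destruct (Rle_dec t 0) as [H'|_]; [lra|].
      destruct k as [|k]; simpl pred; [simpl; field; lra|].
      simpl pow; field; lra.
Qed.

Lemma smooth_flat k : smooth_fun (fun _ => True) (flat k).
Proof.
apply smooth_Ck; intros n; revert k; induction n as [|n IH]; intros k; [exact Logic.I|].
assert (oT := open_true (T := R_UniformSpace)).
split; [intros t _; eexists; apply is_derive_flat|].
apply (Ck_ext _ n (fun t => flat (S (S k)) t + (- INR k) * flat (S k) t)).
- exact oT.
- intros t _; symmetry; rewrite (is_derive_unique _ _ _ (is_derive_flat k t)); ring.
- apply Ck_plus; [exact oT | apply IH | apply Ck_mult; [exact oT | | apply IH]].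
  apply smooth_Ck, smooth_const, oT.
Qed.

Definition bump (c d t : R) : R := flat 0 (t - c) * flat 0 (d - t).

Lemma smooth_bump I c d : open I -> smooth_fun I (bump c d).
Proof.
intros oI; apply smooth_mult; [exact oI| |];
  apply (smooth_comp I (fun _ => True) (flat 0)); auto; try apply smooth_flat;
  apply smooth_minus; auto; first [apply smooth_id, oI | apply smooth_const, oI].
Qed.

Lemma bump_pos c d t : c < t < d -> 0 < bump c d t.
Proof. intros H; apply Rmult_lt_0_compat; apply flat_pos; lra. Qed.

Lemma bump_zero c d t : ~ (c < t < d) -> bump c d t = 0.
Proof.
intros H; unfold bump; destruct (Rle_dec t c) as [K|K].
- rewrite (flat_zero 0 (t - c)) by lra; ring.
- rewrite (flat_zero 0 (d - t)) by lra; ring.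
Qed.

(** At a boundary point the derivative exists and can be computed
    from the side where the function is zero. *)
Lemma Derive_zero_outside (I : R -> Prop) c d f : open I -> smooth_fun I f ->
  (forall t, I t -> ~ (c < t < d) -> f t = 0) ->
  forall t, I t -> ~ (c < t < d) -> Derive f t = 0.
Proof.
intros oI Sf Z t It Ht.
destruct (Req_dec (Derive f t) 0) as [E|N]; [exact E|exfalso].
assert (pl : 0 < Rabs (Derive f t) / 2) by (generalize (Rabs_pos_lt _ N); lra).
destruct (is_derive_linear_bound f t (Derive f t) (mkposreal _ pl)) as (r & B).
{ apply (smooth_is_derive I); auto. }
destruct (oI t It) as (r' & Br).
set (h := Rmin r r' / 2).
assert (ph : 0 < h /\ h < r /\ h < r').
{ unfold h, Rmin; generalize (cond_pos r) (cond_pos r'); destruct Rle_dec; intros; lra. }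
assert (K : exists z, Rabs z = h /\ ~ (c < t + z < d)).
{ destruct (Rle_dec t c).
  - exists (- h); rewrite Rabs_Ropp, Rabs_pos_eq; lra.
  - exists h; rewrite Rabs_pos_eq; lra. }
destruct K as (z & zh & Hz).
assert (Iz : I (t + z)).
{ apply Br; unfold ball; simpl; unfold AbsRing_ball, abs, minus, plus, opp; simpl.
  replace (t + z + - t) with z by ring; lra. }
assert (K := B z ltac:(lra)); simpl in K.
rewrite !Z in K by auto.
replace (0 - 0 - Derive f t * z) with (- (Derive f t * z)) in K by ring.
rewrite Rabs_Ropp, Rabs_mult, zh in K.
generalize (Rabs_pos_lt _ N); nra.
Qed.

(** * Families of integrals *)

Lemma continuity_2d_pt_pos f x y : continuity_2d_pt f x y -> 0 < f x y ->
  locally_2d (fun u v => 0 < f u v) x y.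
Proof.
intros C p; destruct (C (mkposreal _ p)) as (d & H); exists d; intros u v hu hv.
assert (K := H u v hu hv); simpl in K; apply Rabs_def2 in K; lra.
Qed.

Lemma continuity_2d_pt_snd f x y : continuity_2d_pt f x y -> continuous (f x) y.
Proof.
intros C; apply continuity_pt_filterlim, continuity_pt_locally; intros e.
destruct (C e) as (d & H); exists d; intros v hv; apply H; [|exact hv].
rewrite Rminus_diag, Rabs_R0; apply cond_pos.
Qed.

Lemma continuity_2d_pt_of_snd (h : R -> R) x y : continuous h y ->
  continuity_2d_pt (fun _ v => h v) x y.
Proof.
intros C; apply (continuity_1d_2d_pt_comp h (fun _ v => v)).
- apply continuity_pt_filterlim, C.
- apply continuity_2d_pt_id2.
Qed.

(** The compactness argument that gives one range of eta for all t in the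
    support of a variation. *)
Lemma uniformly_positive f c d :
  (forall t, c <= t <= d -> continuity_2d_pt f 0 t) -> (forall t, c <= t <= d -> f 0 t = 1) ->
  exists r : posreal, forall eta t, Rabs eta < r -> c <= t <= d -> 0 < f eta t.
Proof.
intros C E; destruct (uniform_continuity_2d_1d' f c d 0 C (mkposreal 1 Rlt_0_1)) as (r & H).
exists r; intros eta t he ht; apply Rabs_def2 in he.
assert (K := H t 0 t eta ht ltac:(generalize (cond_pos r); lra) ht ltac:(lra)).
rewrite Rminus_diag, Rabs_R0, E in K by exact ht.
specialize (K (cond_pos r)); simpl in K; apply Rabs_def2 in K; lra.
Qed.

(** What differentiation under the integral sign needs, in a form that is
    stable under products. *)
Definition C1_family (I : R -> Prop) (f f' : R -> R -> R) : Prop :=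
  forall eta t, I t -> is_derive (fun z => f z t) eta (f' eta t) /\
    continuity_2d_pt f eta t /\ continuity_2d_pt f' eta t.

Lemma C1_family_static I h : (forall t, I t -> continuous h t) ->
  C1_family I (fun _ t => h t) (fun _ _ => 0).
Proof.
intros C eta t It; split; [apply @is_derive_const|split].
- apply continuity_2d_pt_of_snd, C, It.
- apply continuity_2d_pt_const.
Qed.

Lemma C1_family_parameter I : C1_family I (fun eta _ => eta) (fun _ _ => 1).
Proof.
intros eta t It; split; [apply @is_derive_id|split].
- apply continuity_2d_pt_id1.
- apply continuity_2d_pt_const.
Qed.

Lemma C1_family_plus I f g f' g' : C1_family I f f' -> C1_family I g g' ->
  C1_family I (fun eta t => f eta t + g eta t) (fun eta t => f' eta t + g' eta t).
Proof.
intros F G eta t It; destruct (F eta t It) as (F1 & F2 & F3), (G eta t It) as (G1 & G2 & G3).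
split; [apply @is_derive_plus; auto|split]; apply continuity_2d_pt_plus; auto.
Qed.

Lemma C1_family_minus I f g f' g' : C1_family I f f' -> C1_family I g g' ->
  C1_family I (fun eta t => f eta t - g eta t) (fun eta t => f' eta t - g' eta t).
Proof.
intros F G eta t It; destruct (F eta t It) as (F1 & F2 & F3), (G eta t It) as (G1 & G2 & G3).
split; [apply @is_derive_minus; auto|split]; apply continuity_2d_pt_minus; auto.
Qed.

Lemma C1_family_mult I f g f' g' : C1_family I f f' -> C1_family I g g' ->
  C1_family I (fun eta t => f eta t * g eta t)
    (fun eta t => f' eta t * g eta t + f eta t * g' eta t).
Proof.
intros F G eta t It; destruct (F eta t It) as (F1 & F2 & F3), (G eta t It) as (G1 & G2 & G3).
split; [|split].
- apply (is_derive_mult (K := R_AbsRing) (fun z => f z t) (fun z => g z t)); auto.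
  intros; apply Rmult_comm.
- apply continuity_2d_pt_mult; auto.
- apply continuity_2d_pt_plus; apply continuity_2d_pt_mult; auto.
Qed.

Definition row (a v : R -> vec3) (eta t : R) : vec3 := plus (a t) (scal eta (v t)).

Lemma coord_row a v eta t i :
  coord i (row a v eta t) = coord i (a t) + eta * coord i (v t).
Proof. unfold row; rewrite coord_plus, coord_scal; reflexivity. Qed.

Lemma C1_family_ext I f g f' g' : (forall eta t, f eta t = g eta t) ->
  (forall eta t, f' eta t = g' eta t) -> C1_family I f f' -> C1_family I g g'.
Proof.
intros E E' H eta t It; destruct (H eta t It) as (H1 & H2 & H3); split; [|split].
- rewrite <- E'; apply (is_derive_ext (fun z => f z t)); auto.
- apply (continuity_2d_pt_ext f); auto.
- apply (continuity_2d_pt_ext f'); auto.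
Qed.

Definition continuous_curve (I : R -> Prop) (u : R -> vec3) : Prop :=
  forall i t, I t -> continuous (fun z => coord i (u z)) t.

Lemma C1_family_row I a v i : continuous_curve I a -> continuous_curve I v ->
  C1_family I (fun eta t => coord i (row a v eta t)) (fun _ t => coord i (v t)).
Proof.
intros A V.
refine (C1_family_ext I (fun eta t => coord i (a t) + eta * coord i (v t)) _
   (fun eta t => 0 + (1 * coord i (v t) + eta * 0)) _ _ _ _).
- intros eta t; rewrite coord_row; reflexivity.
- intros eta t; ring.
- apply (C1_family_plus I (fun _ t => coord i (a t)) (fun eta t => eta * coord i (v t))
     (fun _ _ => 0) (fun eta t => 1 * coord i (v t) + eta * 0)).
  + apply (C1_family_static I (fun t => coord i (a t))), A.
  + apply (C1_family_mult I (fun eta _ => eta) (fun _ t => coord i (v t)) (fun _ _ => 1) (fun _ _ => 0)).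
    * apply C1_family_parameter.
    * apply (C1_family_static I (fun t => coord i (v t))), V.
Qed.

Lemma C1_family_det3 I (u v z u' v' z' : R -> R -> vec3) :
  (forall i, C1_family I (fun e t => coord i (u e t)) (fun e t => coord i (u' e t))) ->
  (forall i, C1_family I (fun e t => coord i (v e t)) (fun e t => coord i (v' e t))) ->
  (forall i, C1_family I (fun e t => coord i (z e t)) (fun e t => coord i (z' e t))) ->
  C1_family I (fun e t => det3 (u e t) (v e t) (z e t))
    (fun e t => det3 (u' e t) (v e t) (z e t) + det3 (u e t) (v' e t) (z e t)
       + det3 (u e t) (v e t) (z' e t)).
Proof.
intros U V Z; unfold det3.
assert (M := fun i j k => C1_family_mult I _ _ _ _ (U i)
   (C1_family_minus I _ _ _ _ (C1_family_mult I _ _ _ _ (V j) (Z k)) (C1_family_mult I _ _ _ _ (V k) (Z j)))).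
refine (C1_family_ext I _ _ _ _ _ _
  (C1_family_plus I _ _ _ _ (C1_family_minus I _ _ _ _ (M 0 1 2) (M 1 0 2)) (M 2 0 1))%nat);
  intros e t; cbv beta; ring.
Qed.

(** The normalization n = D = 1 at eta = 0 keeps the square root and the
    quotient differentiable near eta = 0, and leaves neither in the derivative. *)
Lemma is_derive_RInt_sqrt I c d h n n' D D' : open I -> c <= d ->
  (forall t, c <= t <= d -> I t) ->
  (forall t, I t -> continuous h t) -> C1_family I n n' -> C1_family I D D' ->
  (forall t, I t -> n 0 t = 1) -> (forall t, I t -> D 0 t = 1) ->
  is_derive (fun eta => RInt (fun t => h t * (sqrt (n eta t) / D eta t)) c d) 0
    (RInt (fun t => h t * (n' 0 t / 2 - D' 0 t)) c d).
Proof.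
intros oI cd sub Ch N Dp n0 D0.
set (f := fun eta t => h t * (sqrt (n eta t) / D eta t)).
set (f' := fun eta t => h t * (n' eta t / (2 * sqrt (n eta t)) / D eta t
     - sqrt (n eta t) * D' eta t / (D eta t * D eta t))).
assert (df : forall eta t, I t -> 0 < n eta t -> 0 < D eta t ->
   is_derive (fun z => f z t) eta (f' eta t)).
{ intros eta t It pn pD; destruct (N eta t It) as (N1 & _), (Dp eta t It) as (D1 & _).
  apply (is_derive_scal (fun z => sqrt (n z t) / D z t)).
  assert (ps : 0 < sqrt (n eta t)) by (apply sqrt_lt_R0, pn).
  replace (n' eta t / (2 * sqrt (n eta t)) / D eta t
     - sqrt (n eta t) * D' eta t / (D eta t * D eta t)) with
   ((n' eta t / (2 * sqrt (n eta t)) * D eta t - sqrt (n eta t) * D' eta t) / D eta t ^ 2)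
   by (field; lra).
  apply (is_derive_div (fun z => sqrt (n z t)) (fun z => D z t)); [|exact D1|lra].
  apply (is_derive_sqrt (fun z => n z t)); auto. }
assert (Cs : forall g eta t, continuity_2d_pt g eta t -> 0 < g eta t ->
    continuity_2d_pt (fun u v => sqrt (g u v)) eta t).
{ intros g eta t Cg p; apply (continuity_1d_2d_pt_comp sqrt g); auto.
  apply continuity_pt_sqrt; lra. }
assert (Ci := continuity_2d_pt_inv); assert (Cm := continuity_2d_pt_mult).
assert (cf : forall eta t, I t -> 0 < n eta t -> 0 < D eta t -> continuity_2d_pt f eta t).
{ intros eta t It pn pD; destruct (N eta t It) as (_ & N2 & N3), (Dp eta t It) as (_ & D2 & D3).
  apply Cm; [apply continuity_2d_pt_of_snd; auto|].
  apply Cm; [apply Cs; auto | apply Ci; auto; lra]. }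
assert (cf' : forall eta t, I t -> 0 < n eta t -> 0 < D eta t -> continuity_2d_pt f' eta t).
{ intros eta t It pn pD; destruct (N eta t It) as (_ & N2 & N3), (Dp eta t It) as (_ & D2 & D3).
  assert (ps : 0 < sqrt (n eta t)) by (apply sqrt_lt_R0, pn).
  apply Cm; [apply continuity_2d_pt_of_snd; auto|].
  apply continuity_2d_pt_minus; apply Cm.
  - apply Cm; auto; apply Ci; [|lra].
    apply Cm; [apply continuity_2d_pt_const | apply Cs; auto].
  - apply Ci; auto; lra.
  - apply Cm; auto.
  - apply Ci; [apply Cm; auto|]; nra. }
destruct (uniformly_positive n c d) as (r1 & P1).
{ intros t ht; apply N; auto. }
{ intros t ht; auto. }
destruct (uniformly_positive D c d) as (r2 & P2).
{ intros t ht; apply Dp; auto. }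
{ intros t ht; auto. }
assert (pr : 0 < Rmin r1 r2) by (apply Rmin_pos; apply cond_pos).
assert (near : locally 0 (fun eta : R => Rabs eta < r1 /\ Rabs eta < r2)).
{ exists (mkposreal _ pr); intros eta He.
  assert (K : Rabs eta < Rmin r1 r2).
  { replace eta with (minus eta 0) by (unfold minus, plus, opp; simpl; ring); exact He. }
  split; (eapply Rlt_le_trans; [exact K|]); [apply Rmin_l | apply Rmin_r]. }
replace (RInt (fun t => h t * (n' 0 t / 2 - D' 0 t)) c d) with
  (RInt (fun t => Derive (fun u => f u t) 0) c d).
- apply (is_derive_RInt_param f c d 0); rewrite ?(Rmin_left c d), ?(Rmax_right c d) by exact cd.
  + refine (filter_imp _ _ _ near); intros eta (h1 & h2) t ht; exists (f' eta t); auto.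
  + intros t ht; apply (continuity_2d_pt_ext_loc f').
    * assert (Q1 := continuity_2d_pt_pos n 0 t (proj1 (proj2 (N 0 t (sub t ht))))
            ltac:(rewrite n0; auto; lra)).
      assert (Q2 := continuity_2d_pt_pos D 0 t (proj1 (proj2 (Dp 0 t (sub t ht))))
            ltac:(rewrite D0; auto; lra)).
      destruct Q1 as (q1 & Q1), Q2 as (q2 & Q2), (oI t (sub t ht)) as (q3 & Q3).
      assert (pq : 0 < Rmin q1 (Rmin q2 q3)) by (repeat apply Rmin_pos; apply cond_pos).
      exists (mkposreal _ pq); simpl; intros u v hu hv.
      assert (M1 := Rmin_l q1 (Rmin q2 q3)); assert (M2 := Rmin_r q1 (Rmin q2 q3)).
      assert (M3 := Rmin_l q2 q3); assert (M4 := Rmin_r q2 q3).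
      symmetry; apply is_derive_unique, df.
      -- apply Q3; unfold ball; simpl; unfold AbsRing_ball, abs, minus, plus, opp; simpl.
         unfold Rminus in hv; lra.
      -- apply Q1; lra.
      -- apply Q2; lra.
    * apply cf'; auto; [rewrite n0 | rewrite D0]; auto; lra.
  + refine (filter_imp _ _ _ near); intros eta (h1 & h2); apply (ex_RInt_continuous (V := R_CompleteNormedModule)).
    rewrite (Rmin_left c d), (Rmax_right c d) by exact cd.
    intros t ht; apply (continuity_2d_pt_snd f), cf; auto.
- apply RInt_ext; rewrite (Rmin_left c d), (Rmax_right c d) by exact cd.
  intros t ht; assert (It : I t) by (apply sub; lra).
  transitivity (f' 0 t).
  + apply is_derive_unique, df; auto; [rewrite n0 | rewrite D0]; auto; lra.
  + unfold f'; rewrite n0, D0, sqrt_1 by exact It.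
    match goal with |- ?l = ?r => change (@eq R l r) end; field.
Qed.

Lemma ex_diff_n_affine I n :
  open I -> forall p q eta t, smooth_fun I p -> smooth_fun I q -> I t ->
  ex_diff_n (fun u v => p v + u * q v) n eta t.
Proof.
intros oI; induction n as [|n IH]; intros p q eta t Sp Sq It;
  assert (C : continuity_2d_pt (fun u v => p v + u * q v) eta t)
   by (apply continuity_2d_pt_plus; [|apply continuity_2d_pt_mult; [apply continuity_2d_pt_id1|]];
       apply continuity_2d_pt_of_snd, (smooth_continuous I); auto).
- split; [exact C | exact Logic.I].
- assert (D1 : forall u v, is_derive (fun z => p v + z * q v) u (q v)).
  { intros u v; auto_derive; [exact Logic.I | ring]. }
  assert (D2 : forall u v, I v -> is_derive (fun z => p z + u * q z) v (Derive p v + u * Derive q v)).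
  { intros u v Iv; apply @is_derive_plus; [apply (smooth_is_derive I); auto|].
    apply is_derive_scal, (smooth_is_derive I); auto. }
  split; [exact C|]; split; [|split; [|split]].
  + eexists; apply D1.
  + eexists; apply D2, It.
  + apply (ex_diff_n_ext_loc (fun u v => q v + u * 0)).
    * apply locally_2d_forall; intros u v; transitivity (q v); [ring|].
      symmetry; apply is_derive_unique, D1.
    * apply (IH q (fun _ => 0)); auto; apply smooth_const, oI.
  + apply (ex_diff_n_ext_loc (fun u v => Derive p v + u * Derive q v)).
    * destruct (oI t It) as (r & Hr); exists r; intros u v _ hv; symmetry.
      apply is_derive_unique, D2, Hr; exact hv.
    * apply IH; auto; apply smooth_Derive; auto.
Qed.

(** * Variations in the direction of e2 *)

(** [c'] holds the coordinates, in the moving frame, of the derivative of the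
    field with coordinates [c]. *)
Definition frame_step (I : R -> Prop) (F : frame) (c c' : R -> vec3) : Prop :=
  exists p q r, is_rel_derive I (omega F) (fun t => coord 0 (c t)) p /\
    is_rel_derive I (omega F) (fun t => coord 1 (c t)) q /\
    is_rel_derive I (omega F) (fun t => coord 2 (c t)) r /\
    forall t, I t -> c' t = (p t - mm F t * coord 2 (c t),
       q t + coord 0 (c t) - ell F t * coord 2 (c t), r t + coord 1 (c t)).

Lemma frame_step_intro I F p q r p' q' r' c' :
  is_rel_derive I (omega F) p p' -> is_rel_derive I (omega F) q q' -> is_rel_derive I (omega F) r r' ->
  (forall t, I t -> c' t = (p' t - mm F t * r t, q' t + p t - ell F t * r t, r' t + q t)) ->
  frame_step I F (fun t => (p t, q t, r t)) c'.
Proof. intros P Q R E; exists p', q', r'; auto. Qed.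

Lemma frame_step_comb I x F c c' : is_frame I x F -> frame_step I F c c' -> forall i,
  is_rel_derive I (omega F) (fun t => coord i (comb (e1 F t) (e2 F t) (e3 F t) (c t)))
    (fun t => coord i (comb (e1 F t) (e2 F t) (e3 F t) (c' t))).
Proof.
intros HF (p & q & r & P & Q & R & E) i.
destruct (frame_rel_derive I x F HF i) as (_ & H1 & H2 & H3).
intros t It; assert (G : is_rel_derive I (omega F) (fun t => coord 0 (c t) * coord i (e1 F t)
   + coord 1 (c t) * coord i (e2 F t) + coord 2 (c t) * coord i (e3 F t))
   (fun t => coord i (comb (e1 F t) (e2 F t) (e3 F t) (c' t)))).
{ eapply rel_derive_eq; [|rel_derive_tac].
  intros u Iu; cbv beta; rewrite coord_comb, (E u Iu); coord_tac; ring. }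
apply (is_derive_ext (fun t => coord 0 (c t) * coord i (e1 F t)
   + coord 1 (c t) * coord i (e2 F t) + coord 2 (c t) * coord i (e3 F t))); [|exact (G t It)].
intros u; symmetry; apply coord_comb.
Qed.

Lemma frame_step_row I F a a' v v' eta : open I ->
  frame_step I F a a' -> frame_step I F v v' ->
  frame_step I F (row a v eta) (row a' v' eta).
Proof.
intros oI (p & q & r & P & Q & R & E) (p' & q' & r' & P' & Q' & R' & E').
assert (K : forall i f f', is_rel_derive I (omega F) (fun t => coord i (a t)) f ->
  is_rel_derive I (omega F) (fun t => coord i (v t)) f' ->
  is_rel_derive I (omega F) (fun t => coord i (row a v eta t)) (fun t => f t + eta * f' t)).
{ intros i f f' H H'.
  apply (rel_derive_ext I _ (fun t => coord i (a t) + eta * coord i (v t))); [exact oI| |].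
  - intros t _; symmetry; apply coord_row.
  - eapply rel_derive_eq; [|rel_derive_tac]; intros t _; cbv beta; ring. }
exists (fun t => p t + eta * p' t), (fun t => q t + eta * q' t), (fun t => r t + eta * r' t).
split; [|split; [|split]]; [apply K; assumption .. |].
intros t It; apply vec3_ext; intros i; rewrite coord_row, (E t It), (E' t It), !coord_row.
destruct i as [|[|i]]; coord_tac; ring.
Qed.

Lemma row_static a v eta t : v t = zero -> row a v eta t = a t.
Proof.
intros E; apply vec3_ext; intros i; rewrite coord_row, E, coord_zero; ring.
Qed.

Lemma row_0 a v t : row a v 0 t = a t.
Proof. apply vec3_ext; intros i; rewrite coord_row; ring. Qed.

Lemma continuous_triple I p q r : smooth_fun I p -> smooth_fun I q -> smooth_fun I r ->
  continuous_curve I (fun t => (p t, q t, r t)).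
Proof.
intros P Q R [|[|i]] t It; [apply (smooth_continuous I p) | apply (smooth_continuous I q)
  | apply (smooth_continuous I r)]; auto.
Qed.

(** In this section m = D l holds; g_i, l_i, b_i stand for the iterated
    D-derivatives of g, l and of the amplitude b0 of the variation. *)
Section Normal_variation.

Variables (I : R -> Prop) (x : R -> vec3) (F : frame) (eps : R).
Variables (g g1 g2 g3 g4 l1 l2 l3 l4 b0 b1 b2 b3 b4 b5 : R -> R).

Hypothesis oI : open I.
Hypothesis Fx : is_frame I x F.
Hypothesis eps2 : eps * eps = 1.
Hypothesis g_pos : forall t, I t -> 0 < g t.
Hypothesis g_ell : forall t, I t -> eps * ell F t * g t ^ 2 = 1.
Hypothesis m_l1 : forall t, I t -> mm F t = l1 t.
Hypothesis (G0 : is_rel_derive I (omega F) g g1) (G1 : is_rel_derive I (omega F) g1 g2)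
  (G2 : is_rel_derive I (omega F) g2 g3) (G3 : is_rel_derive I (omega F) g3 g4).
Hypothesis (L0 : is_rel_derive I (omega F) (ell F) l1) (L1 : is_rel_derive I (omega F) l1 l2)
  (L2 : is_rel_derive I (omega F) l2 l3) (L3 : is_rel_derive I (omega F) l3 l4).
Hypothesis (B0 : is_rel_derive I (omega F) b0 b1) (B1 : is_rel_derive I (omega F) b1 b2)
  (B2 : is_rel_derive I (omega F) b2 b3) (B3 : is_rel_derive I (omega F) b3 b4) (B4 : is_rel_derive I (omega F) b4 b5).
Hypothesis (Sg : smooth_fun I g) (Sg1 : smooth_fun I g1) (Sg2 : smooth_fun I g2)
  (Sg3 : smooth_fun I g3) (Sg4 : smooth_fun I g4).
Hypothesis (Sl1 : smooth_fun I l1) (Sl2 : smooth_fun I l2)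
  (Sl3 : smooth_fun I l3) (Sl4 : smooth_fun I l4).
Hypothesis (Sb0 : smooth_fun I b0) (Sb1 : smooth_fun I b1) (Sb2 : smooth_fun I b2)
  (Sb3 : smooth_fun I b3) (Sb4 : smooth_fun I b4) (Sb5 : smooth_fun I b5).

Let l := ell F.
Let w := omega F.
Let Sl : smooth_fun I l := proj1 (proj2 (proj1 (proj2 Fx))).
Let Sw : smooth_fun I w := proj1 (proj1 (proj2 Fx)).

Definition normal_deformation (eta t : R) : vec3 := plus (x t) (scal (eta * b0 t) (e2 F t)).

(** The successive D-derivatives of x + eta b0 e2 have the coordinates
    a_i + eta v_i in the frame of x: the a_i come from x and the v_i from
    b0 e2. *)
Let a1 (t : R) : vec3 := (1, 0, 0).
Let a2 (t : R) : vec3 := (0, 1, 0).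
Let a3 (t : R) : vec3 := (0, 0, 1).
Let a4 (t : R) : vec3 := (- l1 t, - l t, 0).
Let a5 (t : R) : vec3 := (- l2 t, - 2 * l1 t, - l t).

Let v1 (t : R) : vec3 := (0, b1 t, b0 t).
Let v2 (t : R) : vec3 := (- (l1 t * b0 t), b2 t - l t * b0 t, 2 * b1 t).
Let v3 (t : R) : vec3 :=
  (- (l2 t * b0 t) - 3 * (l1 t * b1 t),
   b3 t - 3 * (l t * b1 t) - 2 * (l1 t * b0 t),
   3 * b2 t - l t * b0 t).
Let v4 (t : R) : vec3 :=
  (l t * l1 t * b0 t - l3 t * b0 t - 4 * (l2 t * b1 t) - 6 * (l1 t * b2 t),
   b4 t - 6 * (l t * b2 t) - 8 * (l1 t * b1 t) - 3 * (l2 t * b0 t) + l t * l t * b0 t,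
   4 * b3 t - 4 * (l t * b1 t) - 3 * (l1 t * b0 t)).
Let v5 (t : R) : vec3 :=
  (- (l4 t * b0 t) - 5 * (l3 t * b1 t) - 10 * (l2 t * b2 t) - 10 * (l1 t * b3 t)
     + 4 * (l1 t * l1 t * b0 t) + l t * l2 t * b0 t + 5 * (l t * l1 t * b1 t),
   b5 t - 10 * (l t * b3 t) - 20 * (l1 t * b2 t) - 15 * (l2 t * b1 t) - 4 * (l3 t * b0 t)
     + 6 * (l t * l1 t * b0 t) + 5 * (l t * l t * b1 t),
   5 * b4 t - 10 * (l t * b2 t) - 15 * (l1 t * b1 t) - 6 * (l2 t * b0 t)
     + l t * l t * b0 t).

Let triple (p q r p' q' r' : R) : p = p' -> q = q' -> r = r' -> (p, q, r) = (p', q', r').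
Proof. intros -> -> ->; reflexivity. Qed.

Ltac step_tac :=
  eapply frame_step_intro; [rel_derive_tac | rel_derive_tac | rel_derive_tac |];
  let t := fresh in let It := fresh in intros t It; cbv beta; rewrite m_l1 by exact It;
  apply triple; unfold l; ring.

Lemma steps_a : frame_step I F a1 a2 /\ frame_step I F a2 a3 /\ frame_step I F a3 a4 /\
  frame_step I F a4 a5.
Proof.
assert (L0' : is_rel_derive I (omega F) l l1) by exact L0.
unfold a1, a2, a3, a4, a5; split; [|split; [|split]]; step_tac.
Qed.

Lemma steps_v : frame_step I F v1 v2 /\ frame_step I F v2 v3 /\ frame_step I F v3 v4 /\
  frame_step I F v4 v5.
Proof.
assert (L0' : is_rel_derive I (omega F) l l1) by exact L0.
unfold v1, v2, v3, v4, v5; split; [|split; [|split]]; step_tac.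
Qed.

Definition volume_ratio (eta t : R) : R :=
  det3 (row a1 v1 eta t) (row a2 v2 eta t) (row a3 v3 eta t).

(** The factor eps g^2 = 1 / l normalizes the value at eta = 0 to 1. *)
Definition scaled_numerator (eta t : R) : R :=
  eps * g t ^ 2 * length_numerator (row a1 v1 eta t) (row a2 v2 eta t) (row a3 v3 eta t)
    (row a4 v4 eta t) (row a5 v5 eta t).

Lemma w_pos t : I t -> 0 < w t.
Proof. intros It; apply (proj2 (proj2 Fx) t It). Qed.

Let w_nz t (It : I t) : w t <> 0 := Rgt_not_eq _ _ (w_pos t It).

Lemma frame_det_nz t : I t -> det3 (e1 F t) (e2 F t) (e3 F t) <> 0.
Proof. intros It; apply lin_indep3_det3, (proj2 (proj2 Fx) t It). Qed.

Lemma coord_normal_deformation eta t i :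
  coord i (normal_deformation eta t) = coord i (x t) + eta * (b0 t * coord i (e2 F t)).
Proof. unfold normal_deformation; rewrite coord_plus, coord_scal; ring. Qed.

Lemma smooth_normal_deformation eta :
  smooth_curve I x -> smooth_curve I (normal_deformation eta).
Proof.
intros Sx i; apply (smooth_ext I (fun t => coord i (x t) + eta * (b0 t * coord i (e2 F t)))).
- exact oI.
- intros t _; symmetry; apply coord_normal_deformation.
- assert (Se2 := proj1 (proj2 (proj1 Fx))); smooth_tac.
Qed.

Lemma rel_derive_normal_deformation eta i :
  is_rel_derive I w (fun t => coord i (normal_deformation eta t))
  (fun t => coord i (comb (e1 F t) (e2 F t) (e3 F t) (row a1 v1 eta t))).
Proof.
destruct (frame_rel_derive I x F Fx i) as (H0 & H1 & H2 & H3).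
apply (rel_derive_ext I _ (fun t => coord i (x t) + eta * (b0 t * coord i (e2 F t)))).
- exact oI.
- intros t _; symmetry; apply coord_normal_deformation.
- eapply rel_derive_eq; [|rel_derive_tac]; intros t It; cbv beta.
  rewrite coord_comb, !coord_row; unfold a1, v1; coord_tac; ring.
Qed.

Lemma rel_derive_rows eta i :
  let y a v t := comb (e1 F t) (e2 F t) (e3 F t) (row a v eta t) in
  is_rel_derive I w (fun t => coord i (y a1 v1 t)) (fun t => coord i (y a2 v2 t)) /\
  is_rel_derive I w (fun t => coord i (y a2 v2 t)) (fun t => coord i (y a3 v3 t)) /\
  is_rel_derive I w (fun t => coord i (y a3 v3 t)) (fun t => coord i (y a4 v4 t)) /\
  is_rel_derive I w (fun t => coord i (y a4 v4 t)) (fun t => coord i (y a5 v5 t)).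
Proof.
destruct steps_a as (A1 & A2 & A3 & A4), steps_v as (V1 & V2 & V3 & V4).
split; [|split; [|split]]; apply (frame_step_comb I x F); auto; apply frame_step_row; auto.
Qed.

Lemma nondegenerate_normal_deformation eta :
  (forall t, I t -> volume_ratio eta t <> 0) -> nondegenerate I (normal_deformation eta).
Proof.
intros H t It; apply det3_lin_indep3.
rewrite (det3_curve_derive_n I w (normal_deformation eta)
  (fun t => comb (e1 F t) (e2 F t) (e3 F t) (row a1 v1 eta t))
  (fun t => comb (e1 F t) (e2 F t) (e3 F t) (row a2 v2 eta t))
  (fun t => comb (e1 F t) (e2 F t) (e3 F t) (row a3 v3 eta t))); auto.
- rewrite det3_comb; apply Rmult_integral_contrapositive; split.
  + apply pow_nonzero, w_nz, It.
  + apply Rmult_integral_contrapositive; split; [apply frame_det_nz, It | apply H, It].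
- intros i; exact (rel_derive_normal_deformation eta i).
- intros i; exact (proj1 (rel_derive_rows eta i)).
- intros i; exact (proj1 (proj2 (rel_derive_rows eta i))).
Qed.

Lemma frame_normal_deformation eta G :
  is_frame I (normal_deformation eta) G -> forall t, I t ->
  scaled_numerator eta t * w t ^ 2 =
  eps * g t ^ 2 * (volume_ratio eta t ^ 2 * (ell G t * omega G t ^ 2)).
Proof.
intros HG t It.
set (y := fun a v t => comb (e1 F t) (e2 F t) (e3 F t) (row a v eta t)).
destruct (frame_invariant I (normal_deformation eta) G w (y a1 v1) (y a2 v2) (y a3 v3) (y a4 v4) (y a5 v5)
  oI HG Sw w_nz (rel_derive_normal_deformation eta) (fun i => proj1 (rel_derive_rows eta i))
  (fun i => proj1 (proj2 (rel_derive_rows eta i))) (fun i => proj1 (proj2 (proj2 (rel_derive_rows eta i))))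
  (fun i => proj2 (proj2 (proj2 (rel_derive_rows eta i)))) t It) as (_ & E).
unfold length_numerator, det3_second, y in E; rewrite !det3_comb in E.
assert (D := frame_det_nz t It).
unfold scaled_numerator, volume_ratio, length_numerator, det3_second.
set (d := det3 (e1 F t) (e2 F t) (e3 F t)) in *.
apply (Rmult_eq_reg_l (d ^ 2)); [|apply pow_nonzero, D].
match type of E with ?p = ?q => transitivity (eps * g t ^ 2 * p) end; [field|].
rewrite E; ring.
Qed.

(** Positivity of both factors excludes inflection points, because [G] is an
    arbitrary frame of the deformed curve; the second conclusion is the integrand
    of its length. *)
Lemma length_density_normal_deformation eta G t :
  is_frame I (normal_deformation eta) G -> I t ->
  0 < volume_ratio eta t -> 0 < scaled_numerator eta t ->
  ell G t <> 0 /\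
  length_density G t = w t / g t * (sqrt (scaled_numerator eta t) / volume_ratio eta t).
Proof.
intros HG It pD pN.
assert (E := frame_normal_deformation eta G HG t It).
assert (pw := w_pos t It); assert (pg := g_pos t It).
assert (pG : 0 < omega G t) by apply (proj2 (proj2 HG) t It).
assert (K : eps * ell G t * omega G t ^ 2 = (w t / g t) ^ 2 * (scaled_numerator eta t / volume_ratio eta t ^ 2)).
{ apply (Rmult_eq_reg_l (g t ^ 2 * volume_ratio eta t ^ 2)).
  - replace (g t ^ 2 * volume_ratio eta t ^ 2 * (eps * ell G t * omega G t ^ 2)) with
      (eps * g t ^ 2 * (volume_ratio eta t ^ 2 * (ell G t * omega G t ^ 2))) by ring.
    rewrite <- E; field; lra.
  - apply Rmult_integral_contrapositive; split; apply pow_nonzero; lra. }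
assert (pK : 0 < eps * ell G t).
{ apply (Rmult_lt_reg_r (omega G t ^ 2)); [apply pow_lt, pG|].
  rewrite Rmult_0_l, K; apply Rmult_lt_0_compat; [apply pow_lt, Rdiv_lt_0_compat; auto|].
  apply Rdiv_lt_0_compat; [auto | apply pow_lt, pD]. }
split; [intros Z; rewrite Z in pK; lra|].
assert (Es : sign (ell G t) = eps).
{ destruct (Rtotal_order (ell G t) 0) as [Z|[Z|Z]].
  - rewrite sign_eq_m1 by exact Z; nra.
  - rewrite Z in pK; lra.
  - rewrite sign_eq_1 by exact Z; nra. }
unfold length_density; rewrite Es.
apply Rsqr_inj.
- apply Rmult_le_pos; [apply sqrt_pos | lra].
- apply Rmult_le_pos; [left; apply Rdiv_lt_0_compat; auto|].
  apply Rmult_le_pos; [apply sqrt_pos | left; apply Rinv_0_lt_compat, pD].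
- rewrite !Rsqr_mult, Rsqr_div', Rsqr_div', !Rsqr_sqrt by lra.
  unfold Rsqr; replace (eps * ell G t * (omega G t * omega G t)) with (eps * ell G t * omega G t ^ 2) by ring.
  rewrite K; field; lra.
Qed.

Lemma volume_ratio_static eta t :
  v1 t = zero -> v2 t = zero -> v3 t = zero -> volume_ratio eta t = 1.
Proof.
intros E1 E2 E3; unfold volume_ratio; rewrite !row_static by assumption.
unfold det3, a1, a2, a3; coord_tac; ring.
Qed.

Lemma volume_ratio_0 t : volume_ratio 0 t = 1.
Proof. unfold volume_ratio; rewrite !row_0; unfold det3, a1, a2, a3; coord_tac; ring. Qed.

Lemma length_numerator_frame t :
  length_numerator (a1 t) (a2 t) (a3 t) (a4 t) (a5 t) = l t.
Proof. unfold length_numerator, det3_second, det3, a1, a2, a3, a4, a5; coord_tac; field. Qed.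

Lemma scaled_numerator_0 t : I t -> scaled_numerator 0 t = 1.
Proof.
intros It; unfold scaled_numerator; rewrite !row_0, length_numerator_frame, <- (g_ell t It); unfold l; ring.
Qed.

Lemma scaled_numerator_static eta t : I t -> v1 t = zero -> v2 t = zero -> v3 t = zero ->
  v4 t = zero -> v5 t = zero -> scaled_numerator eta t = 1.
Proof.
intros It E1 E2 E3 E4 E5; unfold scaled_numerator; rewrite !row_static, length_numerator_frame by assumption.
rewrite <- (g_ell t It); unfold l; ring.
Qed.

Lemma continuous_rows :
  (continuous_curve I a1 /\ continuous_curve I a2 /\ continuous_curve I a3 /\
   continuous_curve I a4 /\ continuous_curve I a5) /\
  (continuous_curve I v1 /\ continuous_curve I v2 /\ continuous_curve I v3 /\
   continuous_curve I v4 /\ continuous_curve I v5).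
Proof.
assert (Sl' : smooth_fun I l) by exact Sl.
split; (split; [|split; [|split; [|split]]]); apply continuous_triple; smooth_tac.
Qed.

Lemma C1_family_det_rows a v b z c y : continuous_curve I a -> continuous_curve I v ->
  continuous_curve I b -> continuous_curve I z -> continuous_curve I c -> continuous_curve I y ->
  C1_family I (fun e t => det3 (row a v e t) (row b z e t) (row c y e t))
    (fun e t => det3 (v t) (row b z e t) (row c y e t) + det3 (row a v e t) (z t) (row c y e t)
       + det3 (row a v e t) (row b z e t) (y t)).
Proof.
intros; apply (C1_family_det3 I (row a v) (row b z) (row c y) (fun _ => v) (fun _ => z) (fun _ => y));
  intros i; apply C1_family_row; assumption.
Qed.

(** Let D^4 X = A D^3 X + B D^2 X + C D X be the equation of the deformed curve X,
    with delta the derivative at eta = 0.  The factor of 2/3 is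
    D (delta A), where delta A = 4 D^3 b - 2 D (l b), and the other term is delta B. *)
Lemma first_variation :
  exists n' D', C1_family I scaled_numerator n' /\ C1_family I volume_ratio D' /\
  forall t, I t -> n' 0 t / 2 - D' 0 t = eps * g t ^ 2 / 2 *
    (2 / 3 * (4 * b4 t - 2 * l t * b2 t - 4 * l1 t * b1 t - 2 * l2 t * b0 t)
     - (b4 t - 5 * l t * b2 t - 7 * l1 t * b1 t - 3 * l2 t * b0 t)).
Proof.
destruct continuous_rows as ((A1 & A2 & A3 & A4 & A5) & (V1 & V2 & V3 & V4 & V5)).
assert (D := C1_family_det_rows a1 v1 a2 v2 a3 v3 A1 V1 A2 V2 A3 V3).
assert (D1 := C1_family_det_rows a1 v1 a2 v2 a4 v4 A1 V1 A2 V2 A4 V4).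
assert (D2 := C1_family_plus I _ _ _ _ (C1_family_det_rows a1 v1 a3 v3 a4 v4 A1 V1 A3 V3 A4 V4)
   (C1_family_det_rows a1 v1 a2 v2 a5 v5 A1 V1 A2 V2 A5 V5)).
assert (Bn := C1_family_det_rows a1 v1 a4 v4 a3 v3 A1 V1 A4 V4 A3 V3).
assert (Cst := fun k => C1_family_static I (fun _ => k) (fun t _ => continuous_const k t)).
assert (Cg : C1_family I (fun _ t => eps * g t ^ 2) (fun _ _ => 0)).
{ apply (C1_family_static I (fun t => eps * g t ^ 2)); intros t It.
  apply (smooth_continuous I); auto.
  apply (smooth_ext I (fun t => eps * (g t * g t))); [exact oI | intros; ring | smooth_tac]. }
assert (N := C1_family_mult I _ _ _ _ Cg (C1_family_minus I _ _ _ _ (C1_family_minus I _ _ _ _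
   (C1_family_mult I _ _ _ _ (C1_family_mult I _ _ _ _ (Cst (2 / 3)) D2) D)
   (C1_family_mult I _ _ _ _ (Cst (35 / 36)) (C1_family_mult I _ _ _ _ D1 D1)))
   (C1_family_mult I _ _ _ _ Bn D))).
eexists; eexists; split; [exact N|split; [exact D|]].
intros t It; cbv beta; rewrite !row_0.
assert (El := g_ell t It); fold l in El.
(* The factor eps l g^2 = 1 turns the term - d into - 2 l d inside the bracket. *)
assert (alg : forall q n d r, n = 2 * l t * d + r ->
   (0 * q + eps * g t ^ 2 * n) / 2 - d = eps * g t ^ 2 / 2 * r).
{ intros q n d r ->.
  transitivity (eps * g t ^ 2 / 2 * (2 * l t * d + r) - eps * l t * g t ^ 2 * d); [rewrite El|]; field. }
apply alg.
unfold det3_second, det3, a1, a2, a3, a4, a5, v1, v2, v3, v4, v5; coord_tac; field.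
Qed.

(** The boundary term obtained by moving all derivatives from b to g, l. *)
Let Phi (t : R) : R :=
  2 / 3 * (g t * (4 * b3 t - 2 * (l t * b1 t) - 2 * (l1 t * b0 t)))
  - 2 / 3 * (4 * (g1 t * b2 t) - 4 * (g2 t * b1 t) + 4 * (g3 t * b0 t)
      - 2 * (g1 t * l t * b0 t))
  - (g t * b3 t - g1 t * b2 t + g2 t * b1 t - g3 t * b0 t)
  + 5 * (g t * l t * b1 t) - 5 * (g1 t * l t * b0 t) + 2 * (g t * l1 t * b0 t).

(** Obtained by differentiating l g^2 = eps twice. *)
Lemma ell_jets t : I t -> l t = eps / g t ^ 2 /\ l1 t = -2 * eps * g1 t / g t ^ 3 /\
  l2 t = eps * (-2 * g2 t / g t ^ 3 + 6 * g1 t ^ 2 / g t ^ 4).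
Proof.
assert (L0' : is_rel_derive I w l l1) by exact L0.
assert (E0 : forall t, I t -> l t * (g t * g t) = eps).
{ intros u Iu; rewrite <- (Rmult_1_r eps), <- (g_ell u Iu).
  transitivity (eps * eps * (l u * (g u * g u))); [rewrite eps2|unfold l]; ring. }
assert (E1 := fun u Iu => rel_derive_unique I w _ _ _ _ oI w_nz
  (rel_derive_mult I w _ _ _ _ L0' (rel_derive_mult I w _ _ _ _ G0 G0)) (rel_derive_const I w eps) E0 u Iu).
assert (E2 := fun u Iu => rel_derive_unique I w _ _ _ _ oI w_nz
  (rel_derive_plus I w _ _ _ _
    (rel_derive_mult I w _ _ _ _ L1 (rel_derive_mult I w _ _ _ _ G0 G0))
    (rel_derive_mult I w _ _ _ _ L0'
       (rel_derive_plus I w _ _ _ _ (rel_derive_mult I w _ _ _ _ G1 G0) (rel_derive_mult I w _ _ _ _ G0 G1))))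
  (rel_derive_const I w 0) E1 u Iu).
intros It; generalize (E0 t It) (E1 t It) (E2 t It); clear E0 E1 E2; intros E0 E1 E2.
assert (pg := g_pos t It).
assert (F0 : l t = eps / g t ^ 2) by (rewrite <- E0; field; lra).
assert (F1 : l1 t = -2 * eps * g1 t / g t ^ 3).
{ apply (Rmult_eq_reg_r (g t * g t)); [|nra].
  transitivity (- (l t * (g1 t * g t + g t * g1 t))); [lra|]; rewrite F0; field; lra. }
split; [exact F0|split; [exact F1|]].
apply (Rmult_eq_reg_r (g t * g t)); [|nra].
transitivity (- (l1 t * (g1 t * g t + g t * g1 t) + (l1 t * (g1 t * g t + g t * g1 t) +
  l t * (g2 t * g t + g1 t * g1 t + (g1 t * g1 t + g t * g2 t))))); [lra|].
rewrite F1, F0; field; lra.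
Qed.

(** After integration by parts the coefficient of b0 is
    (5/3) D^4 g + (11/3) l D^2 g + 3 (D l)(D g) + (D^2 l) g.  Substituting
    l = eps / g^2 makes the terms in (D g)^2 cancel. *)
Lemma integration_by_parts :
  exists Phi', is_rel_derive I w Phi Phi' /\ smooth_fun I Phi' /\
  forall t, I t ->
  g t * (2 / 3 * (4 * b4 t - 2 * l t * b2 t - 4 * l1 t * b1 t - 2 * l2 t * b0 t)
     - (b4 t - 5 * l t * b2 t - 7 * l1 t * b1 t - 3 * l2 t * b0 t)) =
  Phi' t + 5 / 3 * (b0 t * (g4 t + eps * g2 t / g t ^ 2)).
Proof.
assert (L0' : is_rel_derive I w l l1) by exact L0; assert (Sl' : smooth_fun I l) by exact Sl.
eexists; split; [|split].
- unfold Phi; rel_derive_tac.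
- cbv beta; smooth_tac.
- intros t It; cbv beta.
  destruct (ell_jets t It) as (E0 & E1 & E2); rewrite E0, E1, E2.
  assert (pg := g_pos t It); field; lra.
Qed.

(** Extremality is tested on the deformation x + eta b0 e2, for eta so
    small that both factors of the length density are positive; outside
    [c, d] they are equal to 1. *)
Lemma extremal_integral c d : smooth_curve I x -> extremal I x ->
  c <= d -> (forall t, c <= t <= d -> I t) ->
  (forall t, I t -> ~ (c < t < d) ->
     b0 t = 0 /\ b1 t = 0 /\ b2 t = 0 /\ b3 t = 0 /\ b4 t = 0 /\ b5 t = 0) ->
  RInt (fun t => w t * (b0 t * (g4 t + eps * g2 t / g t ^ 2))) c d = 0.
Proof.
intros Sx ext cd sub Zb.
destruct first_variation as (n' & D' & Pn & PD & FV).
destruct integration_by_parts as (Phi' & MPhi & SPhi' & IBP).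
destruct (uniformly_positive scaled_numerator c d) as (r1 & P1).
{ intros t ht; apply Pn, sub, ht. }
{ intros t ht; apply scaled_numerator_0, sub, ht. }
destruct (uniformly_positive volume_ratio c d) as (r2 & P2).
{ intros t ht; apply PD, sub, ht. }
{ intros t ht; apply volume_ratio_0. }
set (r := Rmin r1 r2).
assert (pr : 0 < r) by (apply Rmin_pos; apply cond_pos).
assert (rr : r <= r1 /\ r <= r2) by (split; [apply Rmin_l | apply Rmin_r]).
assert (pos : forall eta t, Rabs eta < r -> I t -> 0 < scaled_numerator eta t /\ 0 < volume_ratio eta t).
{ intros eta t he It; destruct (Rle_dec c t) as [h1|h1]; [destruct (Rle_dec t d) as [h2|h2]|].
  1: split; [apply P1 | apply P2]; lra.
  all: destruct (Zb t It) as (Z0 & Z1 & Z2 & Z3 & Z4 & Z5); [lra|].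
  all: assert (zero_triple : forall p q s, p = 0 -> q = 0 -> s = 0 -> (p, q, s) = (zero : vec3))
     by (intros p q s -> -> ->; reflexivity).
  all: rewrite scaled_numerator_static, volume_ratio_static; try (split; lra); try exact It;
    apply zero_triple; rewrite ?Z0, ?Z1, ?Z2, ?Z3, ?Z4, ?Z5; ring. }
assert (def : compact_deformation I x c d r normal_deformation).
{ split; [split; [|split; [|split]]; [lra | lra | apply sub; lra | apply sub; lra]|].
  split; [|split; [|split]].
  - intros i n eta t _ It.
    apply (ex_diff_n_ext_loc (fun u v => coord i (x v) + u * (b0 v * coord i (e2 F v)))).
    + apply locally_2d_forall; intros u v; symmetry; apply coord_normal_deformation.
    + apply (ex_diff_n_affine I n oI (fun v => coord i (x v)) (fun v => b0 v * coord i (e2 F v)));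
        auto.
      assert (Se2 := proj1 (proj2 (proj1 Fx))); smooth_tac.
  - intros t _; apply vec3_ext; intros i; rewrite coord_normal_deformation; ring.
  - intros eta t _ It Ht; apply vec3_ext; intros i; rewrite coord_normal_deformation.
    destruct (Zb t It) as (-> & _); [lra|ring].
  - intros eta he; split.
    + apply nondegenerate_normal_deformation; intros t It; generalize (pos eta t he It); lra.
    + intros t It (G & HG & Z); destruct (pos eta t he It) as (p1 & p2).
      destruct (length_density_normal_deformation eta G t HG It p2 p1) as (N & _); auto. }
assert (Fr : forall eta, Rabs eta < r -> is_frame I (normal_deformation eta) (equiaffine_frame (normal_deformation eta))).
{ intros eta he; apply equiaffine_frame_is_frame; auto; [apply smooth_normal_deformation; auto|].
  apply (proj2 (proj2 (proj2 (proj2 def))) eta he). }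
assert (K := ext c d r normal_deformation def _ Fr).
assert (Swg : smooth_fun I (fun t => w t / g t)).
{ apply smooth_div; auto; intros t It; generalize (g_pos t It); lra. }
assert (K' := is_derive_RInt_sqrt I c d (fun t => w t / g t) scaled_numerator n' volume_ratio D' oI cd sub
   (fun t It => smooth_continuous I _ t Swg It) Pn PD scaled_numerator_0 (fun t _ => volume_ratio_0 t)).
apply (is_derive_ext_loc _ (fun eta => RInt (fun t => w t / g t *
    (sqrt (scaled_numerator eta t) / volume_ratio eta t)) c d)) in K.
2: { exists (mkposreal r pr); intros eta he.
  assert (he' : Rabs eta < r).
  { replace eta with (minus eta 0) by (unfold minus, plus, opp; simpl; ring); exact he. }
  apply RInt_ext; rewrite Rmin_left, Rmax_right by exact cd; intros t ht.
  assert (It : I t) by (apply sub; lra); destruct (pos eta t he' It) as (p1 & p2).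
  apply (length_density_normal_deformation eta _ t (Fr eta he') It p2 p1). }
assert (V := eq_trans (eq_sym (is_derive_unique _ _ _ K')) (is_derive_unique _ _ _ K)).
clear K K' def Fr ext.
set (f := fun t => w t * (b0 t * (g4 t + eps * g2 t / g t ^ 2))).
assert (Sf : smooth_fun I f).
{ assert (Sw' : smooth_fun I w) by exact Sw.
  apply (smooth_ext I (fun t => w t * (b0 t * (g4 t + eps * g2 t * / (g t * g t))))).
  - exact oI.
  - intros t It; unfold f, Rdiv; replace (g t ^ 2) with (g t * g t) by ring; reflexivity.
  - smooth_tac; apply smooth_inv; auto; [|smooth_tac].
    intros t It; generalize (g_pos t It); nra. }
assert (Cf : ex_RInt f c d).
{ apply (ex_RInt_continuous (V := R_CompleteNormedModule)); rewrite Rmin_left, Rmax_right by exact cd.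
  intros t ht; apply (smooth_continuous I); auto. }
assert (IPhi : is_RInt (fun t => w t * Phi' t) c d (minus (Phi d) (Phi c))).
{ apply (is_RInt_derive (V := R_CompleteNormedModule) Phi); rewrite Rmin_left, Rmax_right by exact cd; intros t ht.
  - apply MPhi, sub, ht.
  - apply (smooth_continuous I); auto; assert (Sw' : smooth_fun I w) by exact Sw; smooth_tac. }
assert (Z : minus (Phi d) (Phi c) = 0).
{ destruct (Zb c) as (C0 & C1 & C2 & C3 & _); [apply sub; lra | lra|].
  destruct (Zb d) as (E0 & E1 & E2 & E3 & _); [apply sub; lra | lra|].
  unfold Phi; rewrite C0, C1, C2, C3, E0, E1, E2, E3.
  unfold minus, plus, opp; simpl; ring. }
rewrite Z in IPhi; clear Z.
assert (S := is_RInt_plus _ _ c d _ _ (is_RInt_scal _ c d (eps / 2) _ IPhi)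
  (is_RInt_scal _ c d (5 * eps / 6) _ (RInt_correct f c d Cf))).
apply (is_RInt_unique (V := R_CompleteNormedModule)) in S.
assert (nz : eps <> 0) by (intros Z; rewrite Z in eps2; lra).
apply (Rmult_eq_reg_l (5 * eps / 6)); [|lra].
rewrite Rmult_0_r, <- V at 1.
transitivity (plus (scal (eps / 2) 0) (scal (5 * eps / 6) (RInt f c d))).
{ unfold plus, scal; simpl; unfold mult; simpl; ring. }
refine (eq_trans (eq_sym S) _); apply RInt_ext; rewrite Rmin_left, Rmax_right by exact cd; intros t ht.
assert (It : I t) by (apply sub; lra).
rewrite FV by exact It.
assert (pg := g_pos t It).
unfold plus, scal; simpl; unfold mult; simpl; unfold f.
match goal with |- ?l = ?r => change (@eq R l r) end.
transitivity (eps / 2 * w t * (Phi' t + 5 / 3 * (b0 t * (g4 t + eps * g2 t / g t ^ 2)))).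
{ field; lra. }
rewrite <- IBP by exact It; field; lra.
Qed.

End Normal_variation.

(** * The Euler-Lagrange equation *)

(** If the left-hand side were nonzero at t0, it would keep its sign on an
    interval around t0, and a bump function supported there would contradict
    [extremal_integral]. *)
Lemma euler_lagrange I x F eps g : open I -> is_frame I x F -> smooth_curve I x ->
  extremal I x -> eps * eps = 1 -> smooth_fun I g -> (forall t, I t -> 0 < g t) ->
  (forall t, I t -> eps * ell F t * g t ^ 2 = 1) ->
  (forall t, I t -> Derive (ell F) t = mm F t * omega F t) ->
  let D := rel_Derive (omega F) in
  forall t, I t -> D (D (D (D g))) t + eps * D (D g) t / g t ^ 2 = 0.
Proof.
intros oI Fx Sx ext eps2 Sg pg gl ml D t0 It0.
assert (Sw := proj1 (proj1 (proj2 Fx))); assert (Sl := proj1 (proj2 (proj1 (proj2 Fx)))).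
assert (pw : forall t, I t -> 0 < omega F t) by (intros t It; apply (proj2 (proj2 Fx) t It)).
assert (wnz : forall t, I t -> omega F t <> 0) by (intros t It; generalize (pw t It); lra).
assert (SD : forall f, smooth_fun I f -> smooth_fun I (D f)) by (intros; apply smooth_rel_Derive; auto).
assert (MD : forall f, smooth_fun I f -> is_rel_derive I (omega F) f (D f))
  by (intros; apply rel_Derive_correct; auto).
set (E := fun t => D (D (D (D g))) t + eps * D (D g) t / g t ^ 2).
assert (SE : smooth_fun I E).
{ apply (smooth_ext I (fun t => D (D (D (D g))) t + eps * D (D g) t * / (g t * g t))).
  - exact oI.
  - intros t It; unfold E, Rdiv; replace (g t ^ 2) with (g t * g t) by ring; reflexivity.
  - smooth_tac; auto; apply smooth_inv; auto; [|smooth_tac].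
    intros t It; generalize (pg t It); nra. }
change (E t0 = 0); destruct (Req_dec (E t0) 0) as [Z|N]; [exact Z|exfalso].
assert (ploc : locally t0 (fun t => I t /\ 0 < E t0 * E t)).
{ apply filter_and; [exact (oI t0 It0)|].
  apply (filter_imp (fun t => Rabs (E t - E t0) < Rabs (E t0))).
  - intros t ht; unfold Rabs in ht; repeat destruct Rcase_abs; nra.
  - apply (proj1 (filterlim_locally E (E t0)) (smooth_continuous I E t0 SE It0)
      (mkposreal _ (Rabs_pos_lt _ N))). }
destruct ploc as (r & Hr).
set (c := t0 - r / 2); set (d := t0 + r / 2).
assert (pr := cond_pos r); assert (cd : c < d) by (unfold c, d; lra).
assert (near : forall t, c <= t <= d -> I t /\ 0 < E t0 * E t).
{ intros t ht; apply Hr; unfold ball; simpl; unfold AbsRing_ball, abs, minus, plus, opp; simpl.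
  unfold c, d in ht; apply Rabs_def1; lra. }
assert (Sb := smooth_bump I c d oI); set (b := bump c d) in *.
assert (Z0 : forall t, I t -> ~ (c < t < d) -> b t = 0) by (intros; apply bump_zero; auto).
assert (ZD : forall f, smooth_fun I f -> (forall t, I t -> ~ (c < t < d) -> f t = 0) ->
   forall t, I t -> ~ (c < t < d) -> D f t = 0).
{ intros f Sf Zf t It Ht; unfold D, rel_Derive; rewrite (Derive_zero_outside I c d f) by auto.
  unfold Rdiv; ring. }
assert (V : RInt (fun t => omega F t * (b t * E t)) c d = 0).
{ apply (extremal_integral I x F eps g (D g) (D (D g)) (D (D (D g))) (D (D (D (D g))))
    (D (ell F)) (D (D (ell F))) (D (D (D (ell F)))) (D (D (D (D (ell F)))))
    b (D b) (D (D b)) (D (D (D b))) (D (D (D (D b)))) (D (D (D (D (D b)))))); auto 10.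
  - intros t It; unfold D at 1, rel_Derive; rewrite ml by exact It; field; auto.
  - lra.
  - intros t ht; apply near, ht.
  - intros t It Ht; repeat split; revert t It Ht; auto 20. }
set (f := fun t => E t0 * (omega F t * (b t * E t))).
assert (Sf : smooth_fun I f) by (unfold f; smooth_tac).
assert (P : 0 < RInt f c d).
{ apply RInt_gt_0; [exact cd| |].
  - intros t ht; destruct (near t ltac:(lra)) as (It & pE); unfold f.
    replace (E t0 * (omega F t * (b t * E t))) with (omega F t * b t * (E t0 * E t)) by ring.
    apply Rmult_lt_0_compat; [apply Rmult_lt_0_compat; [auto | apply bump_pos, ht] | exact pE].
  - intros t ht; apply (smooth_continuous I); auto; apply near, ht. }
assert (Q : RInt f c d = E t0 * RInt (fun t => omega F t * (b t * E t)) c d).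
{ apply (RInt_scal (V := R_CompleteNormedModule)).
  apply (ex_RInt_continuous (V := R_CompleteNormedModule)).
  rewrite Rmin_left, Rmax_right by lra; intros t ht.
  apply (smooth_continuous I); [smooth_tac | apply near, ht]. }
rewrite Q, V in P; lra.
Qed.

(** * Curves in a linear complex *)

Theorem corollary6p3 (a b : Rbar) (hab : Rbar_lt a b) (x : R -> vec3)
    (hsmooth : smooth_curve (Rbar_interval a b) x)
    (hnondeg : nondegenerate (Rbar_interval a b) x)
    (hinfl : no_affine_inflection (Rbar_interval a b) x)
    (hext : extremal (Rbar_interval a b) x)
    (F : frame) (hF : is_frame (Rbar_interval a b) x F)
    (eps : R) (heps : forall t, Rbar_interval a b t -> eps = sign (ell F t))
    (s k M : R -> R)
    (hs : length_parameter (Rbar_interval a b) F s)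
    (hk : first_curvature (Rbar_interval a b) F s k)
    (hM : second_curvature (Rbar_interval a b) F s M) :
  in_linear_complex (Rbar_interval a b) x <->
  (forall t, Rbar_interval a b t -> M (s t) = eps * k (s t)) /\
  (forall t, Rbar_interval a b t ->
     Derive_n k 3 (s t) + 3 / 2 * k (s t) * Derive_n k 2 (s t)
     + 1 / 2 * (Derive_n k 1 (s t)) ^ 2
     + 1 / 2 * (k (s t)) ^ 2 * Derive_n k 1 (s t)
     + eps * Derive_n k 1 (s t) = 0).
Proof.
assert (oI := Rbar_interval_open a b).
rewrite (linear_complex_iff a b x F hab hF).
destruct (Rbar_interval_inhabited a b hab) as (t0 & It0).
set (I := Rbar_interval a b) in *.
assert (pw : forall t, I t -> 0 < omega F t) by (intros t It; apply (proj2 (proj2 hF) t It)).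
assert (wnz : forall t, I t -> omega F t <> 0) by (intros t It; generalize (pw t It); lra).
assert (Sw := proj1 (proj1 (proj2 hF))); assert (Sl := proj1 (proj2 (proj1 (proj2 hF)))).
assert (pl : forall t, I t -> 0 < eps * ell F t /\ eps * eps = 1).
{ intros t It; rewrite (heps t It).
  destruct (Rtotal_order (ell F t) 0) as [Z|[Z|Z]].
  - rewrite sign_eq_m1 by exact Z; lra.
  - exfalso; apply (hinfl t It); exists F; auto.
  - rewrite sign_eq_1 by exact Z; lra. }
assert (eps2 : eps * eps = 1) by apply (pl t0 It0).
set (g := fun t => / sqrt (eps * ell F t)).
assert (pg : forall t, I t -> 0 < g t).
{ intros t It; apply Rinv_0_lt_compat, sqrt_lt_R0, pl, It. }
assert (gl : forall t, I t -> eps * ell F t * g t ^ 2 = 1).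
{ intros t It; destruct (pl t It) as (p & _); unfold g.
  rewrite <- (pow2_sqrt (eps * ell F t)) at 1 by lra; field.
  generalize (sqrt_lt_R0 _ p); lra. }
assert (Sg : smooth_fun I g).
{ apply (smooth_ext I (fun t => / Rpower (eps * ell F t) (/ 2))).
  - exact oI.
  - intros t It; unfold g; rewrite Rpower_sqrt; [reflexivity | apply pl, It].
  - apply smooth_inv; [exact oI | intros t It; apply Rgt_not_eq, exp_pos |].
    apply (smooth_comp I (fun z => 0 < z) (fun z => Rpower z (/ 2)) (fun t => eps * ell F t));
      [exact oI | intros t It; apply pl, It | apply smooth_Rpower | smooth_tac]. }
set (D := rel_Derive (omega F)).
assert (SD : forall f, smooth_fun I f -> smooth_fun I (D f)) by (intros; apply smooth_rel_Derive; auto).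
assert (MD : forall f, smooth_fun I f -> is_rel_derive I (omega F) f (D f))
  by (intros; apply rel_Derive_correct; auto).
assert (ld : forall t, I t -> length_density F t = omega F t / g t).
{ intros t It; unfold length_density, g; rewrite <- (heps t It); unfold Rdiv.
  rewrite Rinv_inv; ring. }
assert (J := ell_jets I x F eps g (D g) (D (D g)) (D (ell F)) (D (D (ell F))) oI hF eps2 pg gl
   (MD _ Sg) (MD _ (SD _ Sg)) (MD _ Sl) (MD _ (SD _ Sl))).
assert (k0 : forall t, I t -> k (s t) = -2 * D g t).
{ intros t It; destruct (J t It) as (E0 & E1 & _).
  assert (pgt := pg t It); assert (pwt := pw t It).
  assert (H := hk t It); rewrite ld in H by exact It.
  assert (E1' : Derive (ell F) t = D (ell F) t * omega F t)
    by (unfold D, rel_Derive; field; lra).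
  rewrite E1', E0, E1 in H.
  assert (en : eps <> 0) by (intros Z; rewrite Z in eps2; lra).
  apply (Rmult_eq_reg_r (omega F t / g t)); [|apply Rgt_not_eq, Rdiv_lt_0_compat; auto].
  rewrite <- H; field; lra. }
assert (M0 : forall t, I t -> M (s t) = mm F t * g t ^ 3).
{ intros t It; rewrite (hM t It), <- (heps t It); destruct (pl t It) as (p & _).
  replace (3 / 2) with (1 + / 2) by field.
  rewrite Rpower_plus, Rpower_1, Rpower_sqrt by exact p.
  unfold g; rewrite <- (pow2_sqrt (eps * ell F t)) at 1 by lra; field.
  generalize (sqrt_lt_R0 _ p); lra. }
assert (Meq : (forall t, I t -> Derive (ell F) t = mm F t * omega F t) <->
   (forall t, I t -> M (s t) = eps * k (s t))).
{ assert (E1' : forall t, I t -> Derive (ell F) t = D (ell F) t * omega F t)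
    by (intros t It; unfold D, rel_Derive; field; auto).
  split; intros H t It; destruct (J t It) as (_ & E1 & _); assert (pgt := pg t It).
  - assert (K := H t It); rewrite E1' in K by exact It.
    apply Rmult_eq_reg_r in K; [|auto].
    rewrite M0, k0, <- K, E1 by exact It; field; lra.
  - rewrite E1' by exact It; f_equal; rewrite E1.
    assert (K := H t It); rewrite M0, k0 in K by exact It.
    replace (mm F t) with (mm F t * g t ^ 3 / g t ^ 3) by (field; lra).
    rewrite K; field; lra. }
rewrite <- Meq; split; [|intros (H & _); exact H].
intros H; split; [exact H|].
intros t It; change (curvature_ode eps k (s t) = 0).
rewrite (curvature_ode_jets I (omega F) g (D g) (D (D g)) (D (D (D g))) (D (D (D (D g)))));
  auto 10.
- rewrite (euler_lagrange I x F eps g) by auto; ring.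
- intros u Iu; rewrite <- ld by exact Iu; apply hs, Iu.
Qed.
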